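(* The following decision problem is $\mathcal{NP}$-hard. Input: a finite set of targets $T$, a subset $T'\subseteq T$, positive integers $m$ and $k$, and for each resource $i\in\{1,\dots,m\}$ a finite, explicitly listed set $R_i$ of single-resource covering routes, each route $r$ given together with the set $I(r)=\{t\in T : I(r,t)=1\}$ of targets it protects. Question: does there exist a joint covering route $(r_1,\dots,r_m)\in R_1\times\cdots\times R_m$ such that $T'$ is covered using at most $k$ of its single-resource routes, i.e., there is $J\subseteq\{1,\dots,m\}$ with $|J|\le k$ and $T'\subseteq\bigcup_{i\in J} I(r_i)$?
   Context: In the underlying security game, a Defender controls $m$ mobile resources; each resource $i$ has a set $R_i$ of single-resource covering routes available to it, and each route $r$ protects a set of targets, encoded by the indicator $I(r,t)\in\{0,1\}$ ($I(r,t)=1$ iff target $t$ is protected by $r$). A joint covering route is an $m$-tuple $(r_1,\dots,r_m)$ with $r_i\in R_i$ for each $i$. For the purposes of this decision problem the routes are treated as given explicitly by their protected target sets. *)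

(* Defs.v *)
From mathcomp Require Import all_boot.
Set Implicit Arguments. Unset Strict Implicit. Unset Printing Implicit Defensive.

(* Machine model: deterministic single-tape Turing machines over a     *)
(* finite tape alphabet 'I_(S.+3) (0 = blank, 1 = bit false,           *)
(* 2 = bit true, further symbols are auxiliary), with finitely many    *)
(* states 'I_(Q.+1) (start state = 0).  A machine halts when its       *)
(* transition function returns None.                                   *)

Inductive move := MoveL | MoveR | Stay.

Record TM := mkTM {
  tm_Q : nat;
  tm_S : nat;
  tm_delta : 'I_tm_Q.+1 -> 'I_tm_S.+3 ->
             option ('I_tm_Q.+1 * 'I_tm_S.+3 * move) }.

Section Machine.
Variable M : TM.
Local Notation state := ('I_(tm_Q M).+1).
Local Notation sym := ('I_(tm_S M).+3).

(* tape = (cells left of the head, reversed; head cell; cells right) *)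
Definition tape := (seq sym * sym * seq sym)%type.
Definition config := (state * tape)%type.

Definition blank : sym := ord0.
Definition sym_of_bool (b : bool) : sym := if b then inord 2 else inord 1.

Definition move_tape (m : move) (tp : tape) : tape :=
  let: (l, h, r) := tp in
  match m with
  | MoveL => if l is a :: l' then (l', a, h :: r) else ([::], blank, h :: r)
  | MoveR => if r is a :: r' then (h :: l, a, r') else (h :: l, blank, [::])
  | Stay => tp
  end.

Definition step (c : config) : option config :=
  let: (q, (l, h, r)) := c in
  match tm_delta q h with
  | Some (q', s, m) => Some (q', move_tape m (l, s, r))
  | None => None
  end.

Definition halted (c : config) : bool := if step c is None then true else false.

Fixpoint exec (n : nat) (c : config) : config :=
  match n with
  | 0 => c
  | n'.+1 => match step c with Some c' => exec n' c' | None => c end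
  end.

Definition init (w : seq bool) : config :=
  match map sym_of_bool w with
  | [::] => (ord0, ([::], blank, [::]))
  | x :: xs => (ord0, ([::], x, xs))
  end.

Fixpoint read_bits (s : seq sym) : seq bool :=
  match s with
  | [::] => [::]
  | x :: s' => if val x == 1 then false :: read_bits s'
               else if val x == 2 then true :: read_bits s'
               else [::]
  end.

Definition output (c : config) : seq bool :=
  let: (_, (_, h, r)) := c in read_bits (h :: r).

End Machine.

Definition language := seq bool -> Prop.

Definition poly_computable (f : seq bool -> seq bool) : Prop :=
  exists (M : TM) (c d : nat), forall w : seq bool,
    let cf := exec (c * size w ^ d + c) (init M w) in
    halted cf /\ output cf = f w.

Definition poly_decidable (L : language) : Prop :=
  exists (M : TM) (c d : nat), forall w : seq bool,
    let cf := exec (c * size w ^ d + c) (init M w) in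
    halted cf /\
    ((output cf = [:: true] /\ L w) \/ (output cf = [:: false] /\ ~ L w)).

Definition pair_enc (w y : seq bool) : seq bool :=
  flatten (map (fun b => [:: true; b]) w) ++ false :: y.

Definition in_NP (L : language) : Prop :=
  exists V : language, poly_decidable V /\
    exists c d : nat, forall w : seq bool,
      L w <-> exists y : seq bool, size y <= c * size w ^ d + c /\ V (pair_enc w y).

Definition poly_reduces (L1 L2 : language) : Prop :=
  exists f, poly_computable f /\ forall w, L1 w <-> L2 (f w).

Definition NP_hard (L : language) : Prop :=
  forall L' : language, in_NP L' -> poly_reduces L' L.

(* Targets T = {0, ..., nT-1}; T' : seq nat; resources 0..m-1;         *)
(* R : seq (seq (seq nat)) lists, for each resource i, the routes of   *)
(* R_i, each route given by the list of targets I(r) it protects.      *)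

Definition enc_nat (n : nat) : seq bool := nseq n true ++ [:: false].
Definition enc_list {A} (e : A -> seq bool) (s : seq A) : seq bool :=
  enc_nat (size s) ++ flatten (map e s).

Definition enc_inst (nT : nat) (T' : seq nat) (m k : nat)
    (R : seq (seq (seq nat))) : seq bool :=
  enc_nat nT ++ enc_list enc_nat T' ++ enc_nat m ++ enc_nat k ++
  enc_list (enc_list (enc_list enc_nat)) R.

Definition jcr_wf (nT : nat) (T' : seq nat) (m k : nat)
    (R : seq (seq (seq nat))) : Prop :=
  [/\ 0 < m, 0 < k, size R = m,
      all (fun t => t < nT) T' &
      all (all (all (fun t => t < nT))) R].

Definition jcr_yes (T' : seq nat) (m k : nat) (R : seq (seq (seq nat))) : Prop :=
  exists rs : seq (seq nat),
    size rs = m /\ all2 (fun r Ri => r \in Ri) rs R /\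
    exists J : {set 'I_m},
      #|J| <= k /\
      forall t, t \in T' -> exists2 j, j \in J & t \in nth [::] rs j.

Definition jcr_lang : language := fun w =>
  exists nT T' m k R,
    w = enc_inst nT T' m k R /\ jcr_wf nT T' m k R /\ jcr_yes T' m k R.

(* Main.v *)
Require Import Defs.
From mathcomp Require Import all_boot.
From mathcomp Require Import zify.
From Stdlib Require Import FunctionalExtensionality.
Set Implicit Arguments. Unset Strict Implicit. Unset Printing Implicit Defensive.

(** This is the Cook-Levin argument, aimed directly at the covering problem with k = m.
    The tableau of a verifier on its input and a guessed witness is written row after row
    as a single word x_0 x_1 ... of length L with rows of width V + 1, so that being a run
    means that no window (x_r, x_{r+1}, x_{r+2}, x_{r+V+2}) lies in a fixed finite list of
    forbidden quadruples.  Resource s chooses the symbol x_s.  The pairs (window, forbidden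
    quadruple) are the targets, and a choice of x_s protects those pairs in which it differs
    from the corresponding entry of the quadruple; so everything is covered iff the word is
    the tableau of an accepting run.  In unary, target numbers are linear in s, so the
    instance is printed by a few nested loops.  These are run on counters: marks on the
    cells of the single tape of a Turing machine, whose cells also hold the input and the
    output on separate tracks. *)

(** * Constraint words as covering instances *)

(** [poly_computable] asks for a concrete single-tape machine, so the reduction is designed to be
    easy to print. What depends on the verifier alone (the forbidden quadruples, the kinds of
    domains, the routes up to a shift) is constant and can be part of the program; only the input
    and a few sizes are run-time data. For the same reason the forbidden list ignores the position:
    the input, the guessed witness and acceptance are expressed by the domains of the cells. Rows
    follow each other without separators, so a window may straddle two rows; the padding makes this
    harmless. With [k = m] the budget is no restriction, and the hardness lies in choosing one route
    per resource. The running time is taken at the largest length of an encoded pair, so the shape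
    of the tableau depends on the length of the input only. *)

Definition prefix_free {A} (e : A -> seq bool) :=
  forall a b s t, e a ++ s = e b ++ t -> a = b /\ s = t.

Lemma enc_nat_pf : prefix_free enc_nat.
Proof.
rewrite /prefix_free /enc_nat.
elim=> [|a IH] [|b] s t //=; first by case.
by case=> /IH [-> ->].
Qed.

Lemma enc_list_pf A (e : A -> seq bool) : prefix_free e -> prefix_free (enc_list e).
Proof.
move=> pe a b s t; rewrite /enc_list -2!catA => eq.
have {eq} [+ eq] := enc_nat_pf eq; move: eq.
elim: a b => [|x a IH] [|y b] //=; rewrite -!catA => /pe [-> eq] [sz].
by have [-> ->] := IH _ eq sz.
Qed.

(** [jcr_lang] quantifies over all instances with the given code; unique decoding makes a code speak
    of its own instance only. *)
Lemma enc_inst_inj nT T' m k R nT2 T2 m2 k2 R2 :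
  enc_inst nT T' m k R = enc_inst nT2 T2 m2 k2 R2 ->
  [/\ nT = nT2, T' = T2, m = m2, k = k2 & R = R2].
Proof.
move=> e.
have [-> {}e] := enc_nat_pf e.
have [-> {}e] := enc_list_pf enc_nat_pf e.
have [-> {}e] := enc_nat_pf e.
have [-> {}e] := enc_nat_pf e.
have pf := enc_list_pf (enc_list_pf (enc_list_pf enc_nat_pf)).
by have [] := pf R R2 [::] [::]; rewrite ?cats0.
Qed.

Section CSP.
Variables (D : eqType) (forbidden : seq (D * D * D * D)) (V : nat).
Local Notation K := (size forbidden).

(* The target of window r and quadruple j is number (r + V + 2) * K + j, shifted so that no
   subtraction occurs.  Seen from the cells s = r, r+1, r+2 and r+V+2 of the window it is
   s*K + V*K + 2K + j, s*K + V*K + K + j, s*K + V*K + j and s*K + j. *)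
Definition target (s : nat) (bo : bool * nat) := s * K + (if bo.1 then V * K else 0) + bo.2.

(** Up to [target s] a route depends on the value alone, so a program can hold the template as a
    constant. The four parts treat the cell as first, second, third and fourth entry of a window. *)
Definition template (v : D) : seq (bool * nat) :=
  let q := nth (v, v, v, v) forbidden in
  [seq (true, 2 * K + j) | j <- iota 0 K & (q j).1.1.1 != v] ++
  [seq (true, K + j) | j <- iota 0 K & (q j).1.1.2 != v] ++
  [seq (true, j) | j <- iota 0 K & (q j).1.2 != v] ++
  [seq (false, j) | j <- iota 0 K & (q j).2 != v].

Definition route s v := map (target s) (template v).

Lemma block_eq m n i j : i < K -> j < K -> m * K + i = n * K + j -> m = n /\ i = j.
Proof.
move=> iK jK e; have K0 : 0 < K by apply: leq_ltn_trans iK.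
have := congr1 (divn^~ K) e; have := congr1 (modn^~ K) e.
by rewrite !modnMDl !modn_small // !divnMDl // !divn_small // !addn0.
Qed.

(** Quotient and remainder modulo [K] separate window from quadruple, so each part of [template] can
    meet the target from one position only. *)
Lemma mem_route s v r j q0 : j < K ->
  (target r (true, 2 * K + j) \in route s v) =
  let q := nth q0 forbidden j in
  [|| (s == r) && (q.1.1.1 != v), (s == r.+1) && (q.1.1.2 != v),
      (s == r.+2) && (q.1.2 != v) | (s == r + V + 2) && (q.2 != v)].
Proof.
move=> jK; rewrite /= (set_nth_default (v, v, v, v) q0 jK); set q := nth _ _ _.
have et r' o : target r' (true, o) = (r' + V) * K + o by rewrite /target /= mulnDl.
have ef r' o : target r' (false, o) = r' * K + o by rewrite /target /= addn0.
have e2 : target r (true, 2 * K + j) = (r + V + 2) * K + j.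
  by rewrite et addnA -mulnDl.
rewrite e2; apply/mapP/or4P.
- case=> bo; rewrite !mem_cat => /or4P [] /mapP [i];
    rewrite mem_filter mem_iota => /andP [ne /= iK] -> {bo}.
  + rewrite et addnA -mulnDl => /(block_eq jK iK) [e ij]; subst i.
    by apply: Or41; rewrite ne andbT; apply/eqP; lia.
  + rewrite et (_ : _ + (K + i) = (s + V + 1) * K + i) => [|]; last lia.
    move=> /(block_eq jK iK) [e ij]; subst i.
    by apply: Or42; rewrite ne andbT; apply/eqP; lia.
  + rewrite et => /(block_eq jK iK) [e ij]; subst i.
    by apply: Or43; rewrite ne andbT; apply/eqP; lia.
  + rewrite ef => /(block_eq jK iK) [e ij]; subst i.
    by apply: Or44; rewrite ne andbT; apply/eqP; lia.
- case=> /andP [/eqP -> ne].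
  + exists (true, 2 * K + j); last by rewrite et addnA -mulnDl.
    by rewrite mem_cat map_f // mem_filter mem_iota ne.
  + exists (true, K + j).
      by rewrite !mem_cat; apply/or4P/Or42/map_f; rewrite mem_filter mem_iota ne.
    by rewrite et; lia.
  + exists (true, j).
      by rewrite !mem_cat; apply/or4P/Or43/map_f; rewrite mem_filter mem_iota ne.
    by rewrite et; lia.
  + exists (false, j); last by rewrite ef.
    by rewrite !mem_cat; apply/or4P/Or44/map_f; rewrite mem_filter mem_iota ne.
Qed.

Variables (Z : nat) (doms : seq (seq D)).

(** Cells near the ends of the word also protect targets of windows that do not exist; these numbers
    must be legal too, although [csp_targets] omits them. *)
Definition csp_ntargets := (Z + V + 2 + V + 2) * K.

Definition csp_targets : seq nat :=
  flatten [seq [seq target s (true, 2 * K + j) | j <- iota 0 K] | s <- iota 0 Z].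

Definition csp_routes : seq (seq (seq nat)) :=
  [seq [seq route s v | v <- nth [::] doms s] | s <- iota 0 (Z + V + 2)].

Definition csp_sat (x : nat -> D) :=
  (forall s, s < Z + V + 2 -> x s \in nth [::] doms s) /\
  (forall r, r < Z -> (x r, x r.+1, x r.+2, x (r + V + 2)) \notin forbidden).

Lemma csp_wf :
  jcr_wf csp_ntargets csp_targets (Z + V + 2) (Z + V + 2) csp_routes.
Proof.
split; rewrite ?size_map ?size_iota ?ltn_addl //.
- apply/allP => t /flatten_mapP [s]; rewrite mem_iota => /= sZ /mapP [j].
  rewrite mem_iota /= => jK ->; rewrite /target /csp_ntargets /= !mulnDl. nia.
- apply/allP => Ri /mapP [s]; rewrite mem_iota add0n => /andP [_ sL] ->.
  apply/allP => r /mapP [v _ ->]; apply/allP => t /mapP [bo bot ->].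
  have o3 : bo.2 < 3 * K.
    move: bot; rewrite !mem_cat => /or4P [] /mapP [i];
      rewrite mem_filter mem_iota => /andP [_ /= iK] -> /=; lia.
  have := leq_mul sL (leqnn K); rewrite /target /csp_ntargets.
  case: bo bot o3 => [[] o] _ /=; rewrite !mulnDl mulSn; lia.
Qed.

Lemma all2_nth (A B : Type) (p : A -> B -> bool) a0 b0 s t :
  all2 p s t <-> size s = size t /\ forall i, i < size s -> p (nth a0 s i) (nth b0 t i).
Proof.
elim: s t => [|x s IH] [|y t] /=; [by split | by split=> // -[] | by split=> // -[] |].
split=> [/andP [pxy /IH [-> h]]|[[sz] h]]; first by split=> // -[].
by rewrite (h 0) //=; apply/IH; split=> // i; exact: (h i.+1).
Qed.

Lemma csp_yes :
  jcr_yes csp_targets (Z + V + 2) (Z + V + 2) csp_routes <-> exists x, csp_sat x.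
Proof.
set L := Z + V + 2.
have nthR s : s < L -> nth [::] csp_routes s = [seq route s v | v <- nth [::] doms s].
  by move=> sL; rewrite (nth_map 0) ?size_iota // nth_iota.
have sR : size csp_routes = L by rewrite size_map size_iota.
split.
- case=> rs [szr [/(all2_nth _ [::] [::]) [_ hr]] [J [_ cov]]].
  have {}hr s : s < L -> exists2 v, v \in nth [::] doms s & nth [::] rs s = route s v.
    by move=> sL; move: (hr s); rewrite szr nthR // => /(_ sL) /mapP.
  (* [D] is not assumed inhabited; the chosen route of cell [0] supplies a default value. *)
  have [|v0 _ _] := hr 0; first by rewrite /L addn2.
  (* Different values may have equal routes, so a value is recovered from the first index of the
     chosen route. *)
  pose x s := nth v0 (nth [::] doms s) (index (nth [::] rs s) (map (route s) (nth [::] doms s))).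
  have xP s : s < L -> x s \in nth [::] doms s /\ nth [::] rs s = route s (x s).
    move=> /hr [v vd e]; rewrite /x e; set i := index _ _.
    have iS : i < size (nth [::] doms s).
      by rewrite -(size_map (route s)) index_mem map_f.
    by rewrite mem_nth // -(nth_map v0 [::] (route s)) // nth_index ?map_f.
  exists x; split=> [s /xP [] //|r rZ].
  apply/negP => /(nthP (v0, v0, v0, v0)) [j jK e].
  have [|s _] := cov (target r (true, 2 * K + j)).
    by apply/flatten_mapP; exists r; rewrite ?mem_iota //; apply: map_f; rewrite mem_iota.
  rewrite (xP s _).2 // (mem_route _ _ _ (v0, v0, v0, v0)) // e /=.
  by case/or4P => /andP [/eqP ->]; rewrite eqxx.
- case=> x [xd xw]; exists [seq route s (x s) | s <- iota 0 L].
  rewrite size_map size_iota; split=> //; split.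
    apply/(all2_nth _ [::] [::]); rewrite sR size_map size_iota; split=> // s sL.
    by rewrite nthR // (nth_map 0) ?size_iota // nth_iota // map_f // xd.
  exists setT; split; first by rewrite cardsT card_ord.
  move=> t /flatten_mapP [r]; rewrite mem_iota add0n => /= rZ /mapP [j].
  rewrite mem_iota /= add0n => jK ->; set q0 := (x 0, x 0, x 0, x 0).
  suff [s sL ts] : exists2 s, s < L & target r (true, 2 * K + j) \in route s (x s).
    exists (Ordinal sL); rewrite ?in_setT //.
    by rewrite (nth_map 0) ?size_iota // nth_iota.
  have := xw r rZ; have /= := mem_nth q0 jK.
  case e : (nth q0 forbidden j) => [[[a b] c] d] qin.
  have mr s := mem_route s (x s) r q0 jK; rewrite /= e /= in mr.
  case: (altP (a =P x r)) => [ea|na] nq; last first.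
    by exists r; [rewrite /L; lia|rewrite mr eqxx na].
  case: (altP (b =P x r.+1)) => [eb|nb]; last first.
    by exists r.+1; [rewrite /L; lia|rewrite mr eqxx nb orbT].
  case: (altP (c =P x r.+2)) => [ec|nc]; last first.
    by exists r.+2; [rewrite /L; lia|rewrite mr eqxx nc !orbT].
  case: (altP (d =P x (r + V + 2))) => [ed|nd]; last first.
    by exists (r + V + 2); [rewrite /L; lia|rewrite mr eqxx nd !orbT].
  by rewrite -ea -eb -ec -ed qin in nq.
Qed.

Definition csp_enc := enc_inst csp_ntargets csp_targets (Z + V + 2) (Z + V + 2) csp_routes.

Lemma jcr_lang_csp : jcr_lang csp_enc <-> exists x, csp_sat x.
Proof.
rewrite -csp_yes; split=> [[nT [T' [m [k [R [/enc_inst_inj [_ <- <- <- <-] [_ y]]]]]]]|y] //.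
by exists csp_ntargets, csp_targets, (Z + V + 2), (Z + V + 2), csp_routes; split=> //; split=> //; exact: csp_wf.
Qed.

End CSP.

(** * Tapes as functions *)

Definition upd {A} (f : nat -> A) p a := fun i => if i == p then a else f i.
Definition mv m p := match m with MoveL => p.-1 | MoveR => p.+1 | Stay => p end.

Section Rep.
Variable M : TM.
Local Notation sym := ('I_(tm_S M).+3).

(* [f] describes the tape with the head at position [p]; cells at distance
   more than [p] to the left of the head are not described. *)
Definition rep (tp : tape M) (f : nat -> sym) p :=
  let: (l, h, r) := tp in
  [/\ f p = h, forall i, i < p -> f (p - i.+1) = nth (blank M) l i
    & forall i, f (p + i.+1) = nth (blank M) r i].

Lemma rep_ext tp f g p : rep tp f p -> f =1 g -> rep tp g p.
Proof.
by case: tp => [[l h] r] [e hl hr] fg; split=> [|i ip|i]; rewrite -fg ?e ?hl ?hr.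
Qed.

(** The tape of the model grows on both sides, whereas [f] starts at [0]; hence a left move at [0]
    is excluded. *)
Lemma rep_move l h r f p s m : rep (l, h, r) f p -> 0 < p \/ (if m is MoveL then False else True) ->
  rep (move_tape m (l, s, r)) (upd f p s) (mv m p).
Proof.
case=> _ hl hr pm.
have ul i : i < p -> upd f p s (p - i.+1) = nth (blank M) l i.
  by move=> ip; rewrite /upd ifN ?hl //; lia.
have ur i : upd f p s (p + i.+1) = nth (blank M) r i.
  by rewrite /upd ifN ?hr //; lia.
have u0 : upd f p s p = s by rewrite /upd eqxx.
case: m pm => /= pm; last by [].
- have {pm} p0 : 0 < p by case: pm.
  have al i : i < p.-1 -> upd f p s (p.-1 - i.+1) = nth (blank M) l i.+1.
    by move=> ip; rewrite -ul; [congr (upd _ _ _ _); lia | lia].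
  have ar i : upd f p s (p.-1 + i.+1) = nth (blank M) (s :: r) i.
    case: i => [|i]; first by rewrite (_ : _ + 1 = p) //; lia.
    by rewrite -[nth _ _ _]ur; congr (upd _ _ _ _); lia.
  have ah : upd f p s p.-1 = nth (blank M) l 0.
    by rewrite -ul //; congr (upd _ _ _ _); lia.
  by case: l {hl ul} al ah => [|a l] al ah; split=> // i /al; rewrite ?nth_nil.
- have al i : i < p.+1 -> upd f p s (p.+1 - i.+1) = nth (blank M) (s :: l) i.
    by case: i => [|i] ip; [rewrite subn1 | rewrite -[nth _ _ _]ul // subSS].
  have ar i : upd f p s (p.+1 + i.+1) = nth (blank M) r i.+1.
    by rewrite -ur addSnnS.
  have ah : upd f p s p.+1 = nth (blank M) r 0 by rewrite -ur addn1.
  by case: r {hr ur} ar ah => [|a r] ar ah; split=> // i; rewrite ar ?nth_nil.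
Qed.

(** The offset [p] is the room left of the input: [T.+2] cells in the tableau, none for compiled
    machines, which never move left of the origin. *)
Lemma rep_init (w : seq bool) p :
  rep (init M w).2
    (fun i => if i < p then blank M else nth (blank M) (map (sym_of_bool M) w) (i - p)) p.
Proof.
rewrite /init; case: (map _ w) => [|x xs] /=; split.
- by rewrite ltnn nth_nil.
- by move=> i ip; rewrite !nth_nil; case: ifP.
- by move=> i; rewrite !nth_nil; case: ifP.
- by rewrite ltnn subnn.
- by move=> i ip; rewrite nth_nil ifT //; lia.
- by move=> i; rewrite ifF ?addKn //; lia.
Qed.

Lemma init_state w : (init M w).1 = ord0.
Proof. by rewrite /init; case: (map _ w). Qed.

End Rep.

(** * Tableaux *)

Section Tableau.
Variable M : TM.
Local Notation state := ('I_(tm_Q M).+1).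
Local Notation sym := ('I_(tm_S M).+3).
Local Notation blank := (blank M).
Local Notation S := (sym_of_bool M).

(* [None] is an additional start state, from which the head steps right onto the input. *)
Definition tdelta (q : option state) (a : sym) : option (option state * sym * move) :=
  if q is Some q then
    if tm_delta q a is Some (q', s, m) then Some (Some q', s, m) else None
  else Some (Some ord0, a, MoveR).

Definition tconfig := (option state * (nat -> sym) * nat)%type.

(** Halted configurations repeat, so a tableau with a fixed number of rows also records runs that
    halt early. *)
Definition tstep (k : tconfig) : tconfig :=
  let: (q, f, p) := k in
  if tdelta q (f p) is Some (q', s, m) then (q', upd f p s, mv m p) else k.

Definition entry := (sym * option (option state))%type.

Definition tcell (k : tconfig) i : entry :=
  let: (q, f, p) := k in (f i, if i == p then Some q else None).

Definition arrive_right (e : entry) : option (option state) :=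
  if e is (a, Some q) then
    if tdelta q a is Some (q', _, MoveR) then Some q' else None
  else None.

Definition arrive_left (e : entry) : option (option state) :=
  if e is (a, Some q) then
    if tdelta q a is Some (q', _, MoveL) then Some q' else None
  else None.

Definition local_rule (a b c : entry) : entry :=
  match b with
  | (s, Some q) => match tdelta q s with
                   | Some (q', s', Stay) => (s', Some q')
                   | Some (_, s', _) => (s', None)
                   | None => b
                   end
  | (s, None) => (s, if arrive_right a is Some q' then Some q' else arrive_left c)
  end.

Lemma arrive_right_cell k i :
  arrive_right (tcell k i) = if i == k.2 then arrive_right (tcell k k.2) else None.
Proof. by case: k => [[q f] p] /=; case: eqP => [->|] //; rewrite eqxx. Qed.

Lemma arrive_left_cell k i :
  arrive_left (tcell k i) = if i == k.2 then arrive_left (tcell k k.2) else None.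
Proof. by case: k => [[q f] p] /=; case: eqP => [->|] //; rewrite eqxx. Qed.

(** Only the arrivals from [a] and [c] are constrained, because at a row border these cells belong
    to other rows. *)
Lemma local_rule_step k i a c : 0 < k.2 ->
  arrive_right a = (if i == k.2.+1 then arrive_right (tcell k k.2) else None) ->
  arrive_left c = (if i.+1 == k.2 then arrive_left (tcell k k.2) else None) ->
  local_rule a (tcell k i) c = tcell (tstep k) i.
Proof.
case: k => [[q f] p] /= p0; rewrite eqxx.
have [->|ip] := eqVneq i p.
  case: (tdelta q (f p)) => [[[q' s] m]|] _ _ /=; last by rewrite eqxx.
  rewrite /upd eqxx; case: m => /=; rewrite ?eqxx //; first by rewrite ifF //; lia.
  by rewrite ifF //; lia.
move=> -> ->.
case: (tdelta q (f p)) => [[[q' s] m]|] /=; last by rewrite (negbTE ip); do 2 case: ifP.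
rewrite /upd (negbTE ip); congr pair.
case: m => /=.
- rewrite if_same; have -> : (i == p.-1) = (i.+1 == p) by lia.
  by [].
- by rewrite if_same; case: ifP.
- by rewrite !if_same (negbTE ip).
Qed.

Lemma head_range n k : let p := (iter n tstep k).2 in p <= k.2 + n /\ k.2 <= p + n.
Proof.
elim: n => [|n IH] /=; first by rewrite !addn0.
case: (iter n tstep k) IH => [[q f] p] /= [h1 h2].
by case: (tdelta q (f p)) => [[[q' s] []]|] /=; lia.
Qed.

Definition matches (c : config M) (k : tconfig) :=
  k.1.1 = Some c.1 /\ rep c.2 k.1.2 k.2.

(** A head at distance [n] from position [0] cannot try to pass it within [n] steps, so [rep_move]
    applies throughout. *)
Lemma matches_exec n c k : matches c k -> n <= k.2 ->
  matches (exec n c) (iter n tstep k).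
Proof.
elim: n c k => [|n IH] [q [[l h] r]] [[q' f] p] //= [/= -> rp] np.
rewrite -iterS iterSr /=; have fh : f p = h by case: rp.
rewrite fh; case e : (tm_delta q h) => [[[q1 s] m]|] /=.
  apply: IH; last by case: m {e} => /=; lia.
  by split=> //=; apply: rep_move rp _; left; lia.
have -> : iter n tstep (Some q, f, p) = (Some q, f, p).
  by elim: n {IH np} => //= n ->; rewrite /= fh e.
by split.
Qed.

(* The symbols [inr o] fill the witness region of the first row: its cells guess a bit or
   a blank, and a window containing a blank followed by a bit is forbidden. *)
Definition symbol := (entry + option bool)%type.

Definition flat (d : symbol) : entry :=
  match d with
  | inl e => e
  | inr o => (if o is Some b then S b else blank, None)
  end.

Definition window_ok (a b c d : symbol) : bool :=
  ~~ ((a == inr None) && (if b is inr (Some _) then true else false)) &&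
  (d == inl (local_rule (flat a) (flat b) (flat c))).

Definition forbidden : seq (symbol * symbol * symbol * symbol) :=
  [seq q <- enum {: symbol * symbol * symbol * symbol} |
    ~~ window_ok q.1.1.1 q.1.1.2 q.1.2 q.2].

Lemma notin_forbidden a b c d : ((a, b, c, d) \notin forbidden) = window_ok a b c d.
Proof. by rewrite mem_filter mem_enum andbT negbK. Qed.

Definition plain (a : sym) : symbol := inl (a, None).

(** The output of a decider is one bit and starts at the head, so the symbol under the head decides
    acceptance. *)
Definition accept_dom : seq symbol :=
  [seq d <- enum {: symbol} | if d is inl (s, Some _) then val s == 2 else true].

Definition witness_dom : seq symbol := [:: inr None; inr (Some true); inr (Some false)].

Lemma in_witness_dom d : (d \in witness_dom) = (if d is inr _ then true else false).
Proof. by case: d => [|[[]|]]. Qed.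

Section Word.
Variables (w : seq bool) (B T : nat).

Local Notation N := (2 * size w + 1 + B).
(* The blank padding keeps the head strictly inside the rows 0, ..., T + 2, so the
   neighbours of a border cell, which belong to adjacent rows, do not affect it. *)
Definition tab_V := 2 * T + 3 + N.
Local Notation V := tab_V.
Definition tab_Z := V.+1 * T.+1.
Local Notation Z := tab_Z.
Local Notation P := V.+1.
Local Notation st := (T.+2 + (2 * size w + 1)).

Definition input_dom b : seq symbol := [:: plain (S b)].

(** Windows determine the word from cell [V + 2] on, one cell after the start of the second row;
    hence the last blank block has [T.+3] entries, and the accepting block is the row [T.+1] shifted
    by one cell. *)
Definition doms : seq (seq symbol) :=
  nseq T.+1 [:: plain blank] ++ [:: [:: inl (blank, Some None)]] ++
  map input_dom (pair_enc w [::]) ++ nseq B witness_dom ++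
  nseq T.+3 [:: plain blank] ++ nseq (P * T) (enum {: symbol}) ++ nseq P accept_dom.

Lemma size_pair_enc u v : size (pair_enc u v) = 2 * size u + 1 + size v.
Proof.
rewrite /pair_enc size_cat /= (_ : size (flatten _) = 2 * size u); first by lia.
by elim: u => //= b u ->; lia.
Qed.

Lemma size_pair_enc0 u : size (pair_enc u [::]) = 2 * size u + 1.
Proof. by rewrite size_pair_enc addn0. Qed.

Lemma pair_enc_cat u v : pair_enc u v = pair_enc u [::] ++ v.
Proof. by rewrite /pair_enc -catA. Qed.

Section Fill.
Variable y : seq bool.
Hypothesis yB : size y <= B.

Definition tape0 i :=
  if i < T.+2 then blank else nth blank (map S (pair_enc w y)) (i - T.+2).
(** Row [t.+1] shows the verifier after [t] steps. The extra row puts the head on a blank at first,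
    so its cell does not depend on the input. *)
Definition row t : tconfig := iter t tstep (None, tape0, T.+1).
Definition filling r : symbol :=
  if st <= r < st + B then inr (onth y (r - st))
  else inl (tcell (row (r %/ P)) (r %% P)).

Lemma row_matches t : t <= T.+1 -> matches (exec t (init M (pair_enc w y))) (row t.+1).
Proof.
set w' := pair_enc w y.
move=> tT; rewrite /row iterSr; apply: matches_exec; last by rewrite /=; lia.
split; first by rewrite /= init_state.
apply: rep_ext (rep_init M w' T.+2) _ => i.
by rewrite /= /upd; case: (i =P T.+1) => [->|].
Qed.

(** From row [1] on, the head starts at [T.+2] and makes at most [T.+1] moves, so it stays between
    [1] and [2 * T + 3]. *)
Lemma row_head t : t <= T.+2 -> 0 < (row t).2 < V.
Proof.
case: t => [|t] tT; first by rewrite /= /tab_V; lia.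
rewrite /row iterSr; have := head_range t (tstep (None, tape0, T.+1)); rewrite /= /tab_V; lia.
Qed.

Lemma flat_filling r : flat (filling r) = tcell (row (r %/ P)) (r %% P).
Proof.
rewrite /filling; case: ifP => //= h.
have rP : r < P by rewrite /tab_V; lia.
rewrite divn_small // modn_small //= ifF; last by lia.
congr pair; rewrite /tape0 ifF; last by lia.
rewrite pair_enc_cat map_cat nth_cat size_map size_pair_enc0 ifF; last by lia.
rewrite -subnDA; case: (ltnP (r - st) (size y)) => ry.
  by rewrite (nth_map false) // (onthE _) (nth_map false) // nth_map //.
by rewrite onth_default // nth_default // size_map.
Qed.

Lemma filling_window r : r < Z ->
  window_ok (filling r) (filling r.+1) (filling r.+2) (filling (r + V + 2)).
Proof.
move=> rZ; apply/andP; split.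
  apply/negP => /andP [/eqP]; rewrite /filling.
  case: ifP => // h1 [h2]; case: ifP => // h3.
  case e : (onth y (r.+1 - st)) => [b|] // _.
  have : onth y (r.+1 - st) by rewrite e.
  have : ~~ onth y (r - st) by rewrite h2.
  by rewrite onthNE onthTE; lia.
rewrite !flat_filling; set t := r.+1 %/ P; set p := r.+1 %% P.
have tp : r.+1 = t * P + p by exact: divn_eq.
have pP : p < P by exact: ltn_pmod.
have tT : t <= T.+1 by rewrite -ltnS /t ltn_divLR //; move: rZ; rewrite /tab_Z; lia.
have dm u v : v < P -> (u * P + v) %/ P = u /\ (u * P + v) %% P = v.
  by move=> vP; rewrite divnMDl // modnMDl modn_small // divn_small ?addn0.
have next : filling (r + V + 2) = inl (tcell (row t.+1) p).
  rewrite /filling ifF; last by rewrite /tab_V; lia.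
  rewrite (_ : r + V + 2 = t.+1 * P + p); last by rewrite mulSn; lia.
  by have [-> ->] := dm t.+1 p pP.
rewrite next; apply/eqP; congr inl; symmetry; clear next; clearbody t p.
have h0 := row_head (leqW tT); have h1 := row_head (tT : t.+1 <= T.+2).
apply: local_rule_step; first by case/andP: h0.
(* Across a border the neighbours are the last cell of the previous row and the first cell of the
   next one. By [row_head] neither holds a head, so nothing arrives from them. *)
- rewrite arrive_right_cell; case: p pP tp => [|p] pP tp.
    case: t tp tT h0 h1 => [|t] // tp tT h0 h1.
    rewrite (_ : r = t * P + V); last by move: tp; rewrite mulSn; lia.
    have [-> ->] := dm t V (ltnSn V); rewrite ifF //.
    by have := row_head (leqW (ltnW tT)); lia.
  rewrite (_ : r = t * P + p); last by lia.
  by have [|-> ->] := dm t p; [lia | rewrite eqSS].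
- rewrite arrive_left_cell tp -addnS; case: (ltngtP p.+1 P) => [pV||] //; first 1 last.
  + by lia.
  + move=> [pV]; rewrite pV.
    rewrite (_ : t * P + P = t.+1 * P + 0); last by lia.
    have [|-> ->] := dm t.+1 0; first by [].
    by rewrite !ifF //; lia.
  by have [|-> ->] := dm t p.+1.
Qed.


Lemma mem_initial_dom s d : s < V + 2 ->
  (d \in nth [::] doms s) =
  if st <= s < st + B then (if d is inr _ then true else false) else d == filling s.
Proof.
move=> sV; rewrite /doms !nth_cat !size_nseq size_map size_pair_enc0 [size [:: _]]/=.
have fE : ~~ (st <= s < st + B) ->
    filling s = if s == T.+1 then inl (blank, Some None) else plain (tape0 s).
  move=> ns; rewrite /filling (negbTE ns).
  have [sP|sP] := ltnP s P.
    by rewrite divn_small // modn_small //=; case: ifP => // /eqP ->; rewrite /tape0 ltnSn.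
  (* The one initial cell outside the first row. *)
  have -> : s = 1 * P + 0 by lia.
  rewrite divnMDl // modnMDl div0n mod0n /= /upd /= /tape0 ltn0Sn.
  rewrite ifF ?ifF ?nth_default ?size_map ?size_pair_enc //; rewrite /tab_V; lia.
have [h|h] := boolP (st <= s < st + B).
  rewrite ifF; last by lia.
  rewrite ifF; last by lia.
  rewrite ifF; last by lia.
  by rewrite ifT ?nth_nseq ?ifT ?in_witness_dom //; lia.
rewrite {}fE //.
have [s1|s1] := ltnP s T.+1.
  by rewrite nth_nseq s1 /tape0 ltnS (ltnW s1) ltn_eqF ?inE.
have [s2|s2] := ltnP (s - T.+1) 1.
  have -> : s = T.+1 by lia.
  by rewrite subnn eqxx inE.
rewrite -!subnDA [T.+1 + 1]addn1 [in RHS]ifF; last by lia.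
have [s3|s3] := ltnP (s - T.+2) (2 * size w + 1).
  rewrite (nth_map false) ?size_pair_enc0 // /input_dom inE /tape0 ifF; last by lia.
  rewrite (nth_map false) ?size_pair_enc; last by lia.
  by rewrite (pair_enc_cat w y) nth_cat size_pair_enc0 s3.
rewrite ifF; last by lia.
rewrite ifT; last by move: sV; rewrite /tab_V; lia.
rewrite nth_nseq ifT; last by move: sV; rewrite /tab_V; lia.
rewrite inE /tape0 ifF ?nth_default ?size_map ?size_pair_enc //; lia.
Qed.

End Fill.

Lemma size_doms : size doms = Z + V + 2.
Proof.
rewrite /doms !size_cat !size_nseq size_map size_pair_enc /tab_Z mulnS /=.
by rewrite {3}/tab_V; lia.
Qed.

Lemma option_prefix (o : nat -> option bool) m :
  (forall i, i.+1 < m -> o i = None -> o i.+1 = None) ->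
  exists2 y, size y <= m & forall i, i < m -> o i = onth y i.
Proof.
elim: m => [|m IH] h; first by exists [::].
have [|y ym yo] := IH; first by move=> i im; apply: h; lia.
case e : (o m) => [b|]; last first.
  exists y; first by lia.
  by move=> i; rewrite ltnS leq_eqVlt => /predU1P [->|/yo //]; rewrite onth_default.
have sy : size y = m.
  case: m h ym yo e {IH} => [|m] h ym yo e; first by lia.
  apply/eqP; rewrite eqn_leq ym -onthTE -yo //.
  by case e' : (o m) => //; rewrite (h m) in e.
exists (rcons y b); first by rewrite size_rcons sy.
move=> i; rewrite -cats1 onth_cat sy ltnS => im.
case: ltnP => im'; first exact: yo.
by have -> : i = m by [lia]; rewrite subnn e.
Qed.

(** Once the witness cells are chosen, the word is forced: the other initial cells have singleton
    domains, and a window determines its last entry from earlier ones. So every solution is some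
    [filling y], and the accepting domains test the head of row [T.+1]. *)
Theorem tableau_correct :
  (exists x, csp_sat forbidden V Z doms x) <->
  exists2 y, size y <= B &
    let: (_, (_, h, _)) := exec T (init M (pair_enc w y)) in val h = 2.
Proof.
have late s : s < Z + V + 2 -> V + 2 <= s -> nth [::] doms s =
    if s < V + 2 + P * T then enum {: symbol} else accept_dom.
  move=> s2 s1; rewrite /doms !nth_cat !size_nseq size_map size_pair_enc0 [size [:: _]]/=.
  rewrite ifF; last by rewrite /tab_V in s1; lia.
  rewrite ifF; last by rewrite /tab_V in s1; lia.
  rewrite ifF; last by rewrite /tab_V in s1; lia.
  rewrite ifF; last by rewrite /tab_V in s1; lia.
  rewrite ifF; last by rewrite /tab_V in s1; lia.
  have -> : s - T.+1 - 1 - (2 * size w + 1) - B - T.+3 = s - (V + 2).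
    by rewrite /tab_V; lia.
  rewrite !nth_nseq (_ : (s - (V + 2) < P * T) = (s < V + 2 + P * T)); last by lia.
case: (ltnP s (V + 2 + P * T)) => // _; rewrite ifT //; move: s2; rewrite /tab_Z mulnS; lia.
have final y (yB : size y <= B) : let p := (row y T.+1).2 in
   [/\ V + 2 + P * T <= T.+1 * P + p, T.+1 * P + p < Z + V + 2 &
     let: (q, (_, h, _)) := exec T (init M (pair_enc w y)) in
     filling y (T.+1 * P + p) = inl (h, Some (Some q))].
  have := row_matches yB (leqnSn T); have := row_head yB (leqnSn T.+1).
  case: (exec T _) => [q [[l h] r]] ph [rq [fp _ _]] p; split.
  - by rewrite -/p in ph; rewrite mulSn; lia.
  - by rewrite -/p in ph; rewrite /tab_Z; lia.
  rewrite /filling ifF; last by rewrite mulSn /tab_V; lia.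
  rewrite divnMDl // modnMDl divn_small ?modn_small ?addn0; try (rewrite -/p in ph; lia).
  move: rq fp; rewrite /p; case: (row y T.+1) => [[q' f] p'] /= -> ->.
  by rewrite eqxx.
split=> [[x [xd xw]]|[y yB acc]]; last first.
- exists (filling y); split=> [s sL|r rZ]; last first.
    by rewrite notin_forbidden filling_window.
  have [s0|s0] := ltnP s (V + 2).
    by rewrite (mem_initial_dom yB) //; case: ifP => h; rewrite /filling h ?eqxx.
  rewrite late //; case: ifP => s1; first by rewrite mem_enum.
  rewrite mem_filter mem_enum andbT /filling ifF; last by rewrite /tab_V in s0; lia.
  rewrite /tcell; case e : (row y _) => [[q f] p]; case: eqP => // ps.
  have [] := final _ yB; set p' := (row y T.+1).2 => f1 f2.
  (* The accepting block meets only row [T.+1] and the first cell of the next row. Heads have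
     positive positions, so the only head in it is that of row [T.+1]. *)
  have es : s = T.+1 * P + p'.
    have sdef := divn_eq s P; rewrite ps in sdef.
    have pP : p < P by rewrite -ps ltn_pmod.
    move: e s1 sL sdef; rewrite /p'; move: (s %/ P) => t e s1 sL sdef.
    have t1 : T < t.
      by rewrite ltnNge; apply/negP => /(leq_mul (leqnn P)); move: s1; lia.
    have t2 : t <= T.+2.
      rewrite leqNgt; apply/negP => /(leq_mul (leqnn P)); move: sL.
      by rewrite /tab_Z !mulnS; lia.
    have := row_head yB t2; rewrite e /= => /andP [p0 _].
    suff tT : t = T.+1 by rewrite -[tstep _]/(row y T.+1) sdef -tT e.
    apply/eqP; rewrite eqn_leq t1 andbT leqNgt; apply/negP => /(leq_mul (leqnn P)).
    by move: sL; rewrite /tab_Z !mulnS; lia.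
  case: (exec T _) acc => [q' [[l h] r]] /= vh; rewrite -es /filling ifF; last by rewrite /tab_V in s0; lia.
  by rewrite /tcell e ps eqxx => -[-> _]; rewrite vh.
- have st_le : st + B + T.+2 = P by rewrite /tab_V; lia.
  have PZ : P <= Z by rewrite leq_pmulr.
  have wd i : i < B -> exists o, x (st + i) = inr o.
    (* No witness is known yet; the empty one serves, since inside the guessed region the domain
       does not mention it. *)
    move=> iB; have := xd (st + i); rewrite (@mem_initial_dom [::]) //; last by lia.
    rewrite ifT; last by lia.
    by case: (x _) => [e|o] h; [suff : false by []; apply: h; lia | exists o].
  pose o i := if x (st + i) is inr b then b else None.
  have [i iB oi|y yB yo] := @option_prefix o B.
    have := xw (st + i); rewrite notin_forbidden => /(_ _) /andP [|]; first by lia.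
    move: oi; rewrite /o (addnS st); have [b ->] := wd i (ltnW iB) => ->.
    by have := wd _ iB; rewrite (addnS st) => -[[b'|] -> //]; rewrite eqxx.
  exists y => //.
  have xE s : s < Z + V + 2 -> x s = filling y s.
    elim/ltn_ind: s => s IH sL; have [s1|s1] := ltnP s (V + 2).
      have := xd s sL; rewrite (mem_initial_dom yB) //.
      case: ifP => h; last by move/eqP.
      move=> _; have [|b e] := wd (s - st); first by lia.
      rewrite subnKC in e; last by lia.
      have := yo (s - st); rewrite /o subnKC; last by lia.
      by rewrite e /filling h => <- //; lia.
    have sE : s = s - (V + 2) + V + 2 by lia.
    move: (s - _) sE => r e; subst s.
    (* In [x] and in [filling y] this cell is the local rule applied to three earlier cells, which
       agree by induction. *)
    have := xw r; rewrite notin_forbidden => /(_ _) /andP [|_ /eqP ->]; first by lia.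
    have /andP [_ /eqP ->] : window_ok (filling y r) (filling y r.+1) (filling y r.+2) (filling y (r + V + 2)).
      by apply: filling_window => //; lia.
    by rewrite !IH //; lia.
  have [] := final _ yB; move: (T.+1 * P + _) => s s1 s2.
  have := xd s s2; rewrite xE // late //; last by lia.
  rewrite ltnNge s1 mem_filter.
  by case: (exec T _) => [q [[l h] r]] + e; rewrite e => /andP [/eqP].
Qed.

End Word.
End Tableau.

(** * Tape fragments *)

Lemma upd_id {A} (f : nat -> A) p : upd f p (f p) = f.
Proof. by apply: functional_extensionality => i; rewrite /upd; case: eqP => [->|]. Qed.

Section Fragments.
Variable k : nat.

(* input bit, output bit, marks of the registers pointing here, origin flag *)
Definition cell := (option bool * option bool * {ffun 'I_k -> bool} * bool)%type.

Record frag := Frag {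
  fstate : finType;
  fstart : fstate;
  fdelta : fstate -> cell -> (fstate + bool) * cell * move }.

Definition fconf (F : frag) := ((fstate F + bool) * (nat -> cell) * nat)%type.

(* A fragment blocks instead of moving left of the origin. *)
Definition fstep (F : frag) (c : fconf F) : fconf F :=
  match c with
  | (inl q, f, p) =>
      let: (q', a, m) := fdelta q (f p) in
      if (if m is MoveL then p == 0 else false) then c else (q', upd f p a, mv m p)
  | _ => c
  end.

Definition fruns F n f b f' :=
  iter n (@fstep F) (inl (fstart F), f, 0) = (inr b, f', 0).

Lemma iter_exit F n b f p : iter n (@fstep F) (inr b, f, p) = (inr b, f, p).
Proof. by elim: n => //= n ->. Qed.

Definition embed F G (h : fstate F + bool -> fstate G + bool) (c : fconf F) : fconf G :=
  (h c.1.1, c.1.2, c.2).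

(** [F] idles after its exit, but the image of the exit may be an active state of [G]; hence only
    some [m <= n] steps are copied. *)
Lemma embed_run F G (h : fstate F + bool -> fstate G + bool) :
  (forall q a, exists2 q', h (inl q) = inl q' & fdelta q' a =
     let: (q1, a1, m) := fdelta q a in (h q1, a1, m)) ->
  forall n c b f p, iter n (@fstep F) c = (inr b, f, p) ->
  exists2 m, m <= n & iter m (@fstep G) (embed h c) = embed h (inr b, f, p).
Proof.
move=> hh; elim=> [|n IH] [[[q|b'] f'] p'] b f p.
- by [].
- by move=> /= [-> -> ->]; exists 0.
- rewrite iterSr => /IH [m mn e]; exists m.+1 => //; rewrite iterSr -e; congr iter.
  have [q' hq] := hh q (f' p'); rewrite /embed /= hq => ->.
  case: (fdelta q (f' p')) => [[q1 a1] mo].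
  by case: ifP => _ /=; rewrite ?hq.
- by rewrite iter_exit => -[-> -> ->]; exists 0.
Qed.

Definition branch_entry F G H (q : fstate F + bool) : (fstate F + (fstate G + fstate H)) + bool :=
  match q with
  | inl q => inl (inl q)
  | inr true => inl (inr (inl (fstart G)))
  | inr false => inl (inr (inr (fstart H)))
  end.

Definition branch_then F G H (q : fstate G + bool) : (fstate F + (fstate G + fstate H)) + bool :=
  match q with inl q => inl (inr (inl q)) | inr b => inr b end.

Definition branch_else F G H (q : fstate H + bool) : (fstate F + (fstate G + fstate H)) + bool :=
  match q with inl q => inl (inr (inr q)) | inr b => inr b end.

(** Exits are redirected within the exiting transition, so composition costs no steps. With [G = H]
    this is sequencing. *)
Definition Branch F G H : frag :=
  @Frag (fstate F + (fstate G + fstate H))%type (inl (fstart F))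
    (fun q a => match q with
     | inl q => let: (q1, a1, m) := fdelta q a in (branch_entry G H q1, a1, m)
     | inr (inl q) => let: (q1, a1, m) := fdelta q a in (branch_then F H q1, a1, m)
     | inr (inr q) => let: (q1, a1, m) := fdelta q a in (branch_else F G q1, a1, m)
     end).

Lemma runs_branch F G H n1 n2 b1 b2 f1 f2 f3 :
  fruns F n1 f1 b1 f2 -> (if b1 then fruns G n2 f2 b2 f3 else fruns H n2 f2 b2 f3) ->
  exists2 m, m <= n1 + n2 & fruns (Branch F G H) m f1 b2 f3.
Proof.
move=> r1 r2.
have [|m1 l1 e1] := @embed_run F (Branch F G H) (branch_entry G H) _ _ _ _ _ _ r1.
  by move=> q a; exists (inl q).
suff [m2 l2 e2] : exists2 m2, m2 <= n2 & iter m2 (@fstep (Branch F G H))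
     (embed (G := Branch F G H) (branch_entry G H) (inr b1, f2, 0)) = (inr b2, f3, 0).
  exists (m2 + m1); first by rewrite addnC leq_add.
  rewrite /fruns iterD.
  by rewrite -[X in iter m1 _ X]/(embed (G := Branch F G H) (branch_entry G H) (inl (fstart F), f1, 0)) e1 e2.
case: b1 {r1 e1} r2 => r2.
- have [|m2 l2 e2] := @embed_run G (Branch F G H) (@branch_then F G H) _ _ _ _ _ _ r2; last by exists m2.
  by move=> q a; exists (inr (inl q)).
- have [|m2 l2 e2] := @embed_run H (Branch F G H) (@branch_else F G H) _ _ _ _ _ _ r2; last by exists m2.
  by move=> q a; exists (inr (inr q)).
Qed.

Definition until_test F G (q : fstate F + bool) : (fstate F + fstate G) + bool :=
  match q with
  | inl q => inl (inl q)
  | inr true => inr true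
  | inr false => inl (inr (fstart G))
  end.

Definition until_body F G (q : fstate G + bool) : (fstate F + fstate G) + bool :=
  match q with inl q => inl (inr q) | inr _ => inl (inl (fstart F)) end.

Definition Until F G : frag :=
  @Frag (fstate F + fstate G)%type (inl (fstart F))
    (fun q a => match q with
     | inl q => let: (q1, a1, m) := fdelta q a in (until_test G q1, a1, m)
     | inr q => let: (q1, a1, m) := fdelta q a in (until_body F q1, a1, m)
     end).

Lemma runs_until_stop F G n f1 f2 :
  fruns F n f1 true f2 -> exists2 m, m <= n & fruns (Until F G) m f1 true f2.
Proof.
move=> r1; have [|m l e] := @embed_run F (Until F G) (@until_test F G) _ _ _ _ _ _ r1; last by exists m.
by move=> q a; exists (inl q).
Qed.

Lemma runs_until_go F G n1 n2 n3 f1 f2 f3 f4 b b' :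
  fruns F n1 f1 false f2 -> fruns G n2 f2 b f3 -> fruns (Until F G) n3 f3 b' f4 ->
  exists2 m, m <= n1 + n2 + n3 & fruns (Until F G) m f1 b' f4.
Proof.
move=> r1 r2 r3.
have [|m1 l1 e1] := @embed_run F (Until F G) (@until_test F G) _ _ _ _ _ _ r1.
  by move=> q a; exists (inl q).
have [|m2 l2 e2] := @embed_run G (Until F G) (@until_body F G) _ _ _ _ _ _ r2.
  by move=> q a; exists (inr q).
exists (n3 + (m2 + m1)); first lia.
rewrite /fruns 2!iterD -[X in iter m1 _ X]/(embed (G := Until F G) (@until_test F G) (inl (fstart F), f1, 0)) e1.
by rewrite -[X in iter m2 _ X]/(embed (G := Until F G) (@until_body F G) (inl (fstart G), f2, 0)) e2.
Qed.

Section Visit.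
Variables (t : cell -> bool) (u u1 u0 : cell -> cell) (e : cell -> bool).

(* Scan right for the first cell satisfying [t]; apply [u] there, [u1] to its right
   neighbour and finally [u0] at the origin; exit with the value of [e] at the cell found. *)
Definition Visit : frag :=
  @Frag (option (bool * bool)) None (fun q a =>
    match q with
    | None => if t a then (inl (Some (true, e a)), u a, MoveR) else (inl None, a, MoveR)
    | Some (true, b) => (inl (Some (false, b)), u1 a, MoveL)
    | Some (false, b) =>
        if a.2 then (inr b, u0 a, Stay) else (inl (Some (false, b)), a, MoveL)
    end).

Lemma runs_visit f f' q :
  (forall i, i < q -> ~~ t (f i)) -> t (f q) -> (forall i, (f i).2 = (i == 0)) ->
  (forall a, (u a).2 = a.2) -> (forall a, (u1 a).2 = a.2) ->
  (forall i, f' i =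
     (if i == 0 then u0 else id) ((if i == q.+1 then u1 else id) ((if i == q then u else id) (f i)))) ->
  fruns Visit (2 * q + 3) f (e (f q)) f'.
Proof.
move=> nt tq orig ou ou1 f'E.
have seek i : i <= q -> iter i (@fstep Visit) (inl None, f, 0) = (inl None, f, i).
  by elim: i => //= i IH iq; rewrite IH 1?ltnW //= (negbTE (nt _ _)) //= upd_id.
have back b g i : (forall j, (g j).2 = (j == 0)) ->
    iter i.+1 (@fstep Visit) (inl (Some (false, b)), g, i) = (inr b, upd g 0 (u0 (g 0)), 0).
  move=> go; elim: i => [|i IH]; first by rewrite /= go.
  by rewrite iterSr [fstep _]/= go /= upd_id -iterS IH.
(* [q] steps to the cell, one on it, one on its right neighbour, and [q.+1] back, including the exit
   at the origin. *)
rewrite /fruns (_ : 2 * q + 3 = q.+1 + (1 + (1 + q))); last by lia.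
rewrite 3!iterD seek //= tq /=.
set g := upd (upd f q (u (f q))) q.+1 (u1 (upd f q (u (f q)) q.+1)).
have gE i : g i = (if i == q.+1 then u1 else id) ((if i == q then u else id) (f i)).
  rewrite /g /upd; case: (eqVneq i q.+1) => [->|_].
    by rewrite eqn_leq ltnn.
  by case: eqP => [->|].
rewrite -iterS back; last first.
  by move=> j; rewrite gE; do 2 case: ifP => _; rewrite /= ?ou1 ?ou.
congr (_, _, _); apply: functional_extensionality => i; rewrite f'E -gE /upd.
by case: eqP => [->|].
Qed.

End Visit.
End Fragments.

(** * Counter operations *)

Section Registers.
Variable k : nat.
Local Notation cell := (cell k).
Local Notation frag := (frag k).
Variable w : seq bool.

Definition memory := (seq nat * seq bool)%type.

Definition tape_of (s : memory) (i : nat) : cell :=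
  (onth w i, onth s.2 i, [ffun r : 'I_k => nth 0 s.1 r == i], i == 0).

Definition within n (s : memory) := all (fun x => x <= n) s.1 && (size s.2 <= n).

(* [n] counts elementary operations; each of them takes time linear in the contents of the
   memory, which grows by at most one per operation. *)
Definition evals (F : frag) s n b s' :=
  forall B, within B s -> within (B + n) s' /\
  exists2 m, m <= n * (2 * (B + n) + 5) & fruns F m (tape_of s) b (tape_of s').

Lemma within_le m n s : m <= n -> within m s -> within n s.
Proof.
move=> mn /andP [a b]; apply/andP; split; last exact: leq_trans mn.
by apply: sub_all a => x /leq_trans; apply.
Qed.

Lemma evals_le F s m n b s' : m <= n -> evals F s m b s' -> evals F s n b s'.
Proof.
move=> mn ev B /ev [wB [t tm r]]; split; first by apply: within_le wB; lia.
exists t => //; apply: leq_trans tm _; apply: leq_mul => //; lia.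
Qed.

Lemma evals_branch F G H s n1 n2 b1 b2 s1 s2 :
  evals F s n1 b1 s1 -> (if b1 then evals G s1 n2 b2 s2 else evals H s1 n2 b2 s2) ->
  evals (Branch F G H) s (n1 + n2) b2 s2.
Proof.
move=> ev1 ev2 B /ev1 [wB [m1 l1 r1]].
have [wB2 [m2 l2 r2]] : within (B + n1 + n2) s2 /\
  exists2 m, m <= n2 * (2 * (B + n1 + n2) + 5) &
    if b1 then fruns G m (tape_of s1) b2 (tape_of s2)
    else fruns H m (tape_of s1) b2 (tape_of s2).
  by case: b1 ev2 {r1 ev1} => /(_ _ wB).
rewrite addnA; split=> //; have [m l r] := runs_branch r1 r2.
exists m => //; nia.
Qed.

Lemma evals_until_stop F G s n s' : evals F s n true s' -> evals (Until F G) s n true s'.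
Proof.
move=> ev B /ev [wB [m l /runs_until_stop r]]; split=> //.
by have [m' l' r'] := r G; exists m' => //; apply: leq_trans l.
Qed.

Lemma evals_until_go F G s n1 n2 n3 b b' s1 s2 s3 :
  evals F s n1 false s1 -> evals G s1 n2 b s2 -> evals (Until F G) s2 n3 b' s3 ->
  evals (Until F G) s (n1 + n2 + n3) b' s3.
Proof.
move=> ev1 ev2 ev3 B /ev1 [/ev2 [/ev3 [wB [m3 l3 r3]] [m2 l2 r2]] [m1 l1 r1]].
rewrite !addnA; split=> //; have [m l r] := runs_until_go r1 r2 r3.
exists m => //; nia.
Qed.

Definition set_mark (r : 'I_k) v (c : cell) : cell :=
  (c.1.1, [ffun r' => if r' == r then v else c.1.2 r'], c.2).
Definition set_out b (c : cell) : cell := (c.1.1.1, Some b, c.1.2, c.2).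

(** Incrementing moves the mark to the right neighbour, resetting moves it to the origin; for a mark
    already at the origin it matters that [u0] acts after [u]. Two counters are equal iff their
    marks share a cell. *)
Definition Inc (r : 'I_k) := Visit (fun c : cell => c.1.2 r) (set_mark r false) (set_mark r true) id xpredT.
Definition Reset (r : 'I_k) := Visit (fun c : cell => c.1.2 r) (set_mark r false) id (set_mark r true) xpredT.
Definition Emit b := Visit (fun c : cell => c.1.1.2 == None) (set_out b) id id xpredT.
Definition Same (r r' : 'I_k) := Visit (fun c : cell => c.1.2 r) id id id (fun c => c.1.2 r').
Definition Input (r : 'I_k) x := Visit (fun c : cell => c.1.2 r) id id id (fun c => c.1.1.1 == x).

Lemma within_reg B s r : within B s -> nth 0 s.1 r <= B.
Proof.
case/andP=> /allP a _; case: (ltnP r (size s.1)) => rs; first exact/a/mem_nth.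
by rewrite nth_default.
Qed.

Lemma evals_visit t u u1 u0 e s s' q :
  (forall B, within B s -> q <= B /\ within B.+1 s') ->
  (forall i, i < q -> ~~ t (tape_of s i)) -> t (tape_of s q) ->
  (forall a, (u a).2 = a.2) -> (forall a, (u1 a).2 = a.2) ->
  (forall i, tape_of s' i = (if i == 0 then u0 else id) ((if i == q.+1 then u1 else id)
     ((if i == q then u else id) (tape_of s i)))) ->
  evals (Visit t u u1 u0 e) s 1 (e (tape_of s q)) s'.
Proof.
move=> qB nt tq ou ou1 s'E B /qB [{}qB wB]; rewrite addn1; split=> //.
by exists (2 * q + 3); [lia | apply: runs_visit].
Qed.

Lemma mark_first s (r : 'I_k) :
  (forall i, i < nth 0 s.1 r -> ~~ (tape_of s i).1.2 r) /\ (tape_of s (nth 0 s.1 r)).1.2 r.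
Proof. by split=> [i ir|]; rewrite /= ffunE ?eqxx // gtn_eqF. Qed.

Lemma within_set n s r v : within n s -> v <= n -> within n (set_nth 0 s.1 r v, s.2).
Proof.
case/andP=> /allP a so vn; apply/andP; split=> //; apply/allP => x /(nthP 0) [i _ <-].
rewrite nth_set_nth /=; case: eqP => // _.
by apply: (@within_reg n s); apply/andP; split=> //; apply/allP.
Qed.

Lemma cell_ext (c d : cell) : c.1.1 = d.1.1 -> c.1.2 =1 d.1.2 -> c.2 = d.2 -> c = d.
Proof. by case: c d => [[a f] o] [[a' f'] o'] /= -> /ffunP -> ->. Qed.

Lemma evals_inc r s : evals (Inc r) s 1 true (set_nth 0 s.1 r (nth 0 s.1 r).+1, s.2).
Proof.
have [h1 h2] := mark_first s r.
apply: evals_visit h1 h2 _ _ _ => // [B wB|i].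
  have := within_reg r wB; split=> //; apply: within_set => //; exact: within_le wB.
rewrite if_same; set q := nth 0 s.1 r.
have neq (r' j : nat) : r' != r -> (nth 0 (set_nth 0 s.1 r q.+1) r' == j) = (nth 0 s.1 r' == j).
  by move=> rr; rewrite nth_set_nth /= (negbTE rr).
case: (eqVneq i q.+1) => [->|i1]; last case: (eqVneq i q) => [->|i2];
  rewrite ?(gtn_eqF (ltnSn q)); apply: cell_ext => //= r';
  rewrite !ffunE -?(inj_eq val_inj);
  case: (eqVneq (val r') (val r)) => [->|/neq //]; rewrite nth_set_nth /= !eqxx //.
- by rewrite gtn_eqF.
- by rewrite -/q eq_sym (negbTE i1) eq_sym (negbTE i2).
Qed.

Lemma evals_reset r s : evals (Reset r) s 1 true (set_nth 0 s.1 r 0, s.2).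
Proof.
have [h1 h2] := mark_first s r.
apply: evals_visit h1 h2 _ _ _ => // [B wB|i].
  have := within_reg r wB; split=> //; apply: within_set => //; exact: within_le wB.
rewrite if_same; set q := nth 0 s.1 r.
have neq (r' j : nat) : r' != r -> (nth 0 (set_nth 0 s.1 r 0) r' == j) = (nth 0 s.1 r' == j).
  by move=> rr; rewrite nth_set_nth /= (negbTE rr).
case: (eqVneq i 0) => [->|i1]; case: (eqVneq _ q) => i2;
  apply: cell_ext => //= r';
  rewrite !ffunE -?(inj_eq val_inj);
  case: (eqVneq (val r') (val r)) => [->|/neq //]; rewrite nth_set_nth /= !eqxx //.
- by rewrite eq_sym (negbTE i1).
- by rewrite -/q eq_sym (negbTE i1) eq_sym (negbTE i2).
Qed.

Lemma evals_emit b s : evals (Emit b) s 1 true (s.1, rcons s.2 b).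
Proof.
apply: (@evals_visit _ _ _ _ _ _ _ (size s.2)) => // [B wB|i iq||i].
- case/andP: wB => a so; split=> //; apply/andP; rewrite size_rcons; split=> //.
  by apply: sub_all a => x /leqW.
- by rewrite /=; have := onthTE s.2 i; rewrite iq; case: onth.
- by rewrite /= onth_default.
- rewrite !if_same; case: eqVneq => [->|ne]; apply: cell_ext => //=.
  + by rewrite -cats1 onth_cat ltnn subnn.
  + rewrite -cats1 onth_cat; case: (ltnP i (size s.2)) => // h; congr pair.
    by rewrite !onth_default //= subn_gt0 ltn_neqAle eq_sym ne.
Qed.

Lemma evals_same r r' s : evals (Same r r') s 1 (nth 0 s.1 r' == nth 0 s.1 r) s.
Proof.
have [h1 h2] := mark_first s r.
have := @evals_visit (fun c : cell => c.1.2 r) id id id (fun c => c.1.2 r') s s _ _ h1 h2.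
rewrite /= ffunE; apply=> // [B wB|i]; last by rewrite !if_same.
by split; [apply: within_reg | apply: within_le wB].
Qed.

Lemma evals_input r x s : evals (Input r x) s 1 (onth w (nth 0 s.1 r) == x) s.
Proof.
have [h1 h2] := mark_first s r.
apply: (@evals_visit (fun c : cell => c.1.2 r) id id id (fun c => c.1.1.1 == x) s s _ _ h1 h2) => //
  [B wB|i]; last by rewrite !if_same.
by split; [apply: within_reg | apply: within_le wB].
Qed.
End Registers.

(** * Compilation to Turing machines *)

(** With base [n.+1] a larger exponent never lowers the bound, even at [n = 0], so exponents can be
    added freely. *)
Definition poly_bounded (f : nat -> nat) := exists c d, forall n, f n <= c * n.+1 ^ d.

Lemma poly_bounded_le f g : (forall n, f n <= g n) -> poly_bounded g -> poly_bounded f.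
Proof. by move=> fg [c [d h]]; exists c, d => n; apply: leq_trans (fg n) (h n). Qed.

Lemma poly_bounded_const c : poly_bounded (fun=> c).
Proof. by exists c, 0 => n; rewrite expn0 muln1. Qed.

Lemma poly_bounded_id : poly_bounded id.
Proof. by exists 1, 1 => n; rewrite mul1n expn1. Qed.

Lemma poly_bounded_mul f g :
  poly_bounded f -> poly_bounded g -> poly_bounded (fun n => f n * g n).
Proof.
move=> [c [d hf]] [c' [d' hg]]; exists (c * c'), (d + d') => n.
by rewrite expnD mulnACA leq_mul.
Qed.

Lemma poly_bounded_add f g :
  poly_bounded f -> poly_bounded g -> poly_bounded (fun n => f n + g n).
Proof.
move=> [c [d hf]] [c' [d' hg]]; exists (c + c'), (d + d') => n.
rewrite mulnDl leq_add //.
  by apply: leq_trans (hf n) _; rewrite leq_mul2l leq_pexp2l ?orbT ?leq_addr.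
by apply: leq_trans (hg n) _; rewrite leq_mul2l leq_pexp2l ?orbT ?leq_addl.
Qed.

Lemma poly_bounded_exp f d : poly_bounded f -> poly_bounded (fun n => f n ^ d).
Proof.
move=> pf; elim: d => [|d IH]; first exact: poly_bounded_const.
by apply: poly_bounded_le (poly_bounded_mul pf IH) => n; rewrite expnS.
Qed.

Lemma poly_bounded_standard f : poly_bounded f -> exists c d, forall n, f n <= c * n ^ d + c.
Proof.
(* For positive [n], [n.+1 <= 2 * n]; the additive constant covers [n = 0]. *)
move=> [c [d h]]; exists (c * 2 ^ d), d => n; apply: leq_trans (h n) _.
case: n {h} => [|n]; first by rewrite exp1n muln1; apply: leq_trans (leq_addl _ _); rewrite leq_pmulr ?expn_gt0.
apply: leq_trans (leq_addr _ _); rewrite -mulnA leq_mul2l -expnMn; apply/orP; right.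
by case: d => [|d]; rewrite ?expn0 // leq_exp2r //; lia.
Qed.

Section Exec.
Variable M : TM.

Lemma execD m n (c : config M) : exec (m + n) c = exec n (exec m c).
Proof.
elim: m c => //= m IH c; case e: (step c) => [c'|] //.
by case: n {IH} => //= n; rewrite e.
Qed.

Lemma exec_halted n (c : config M) : halted c -> exec n c = c.
Proof. by rewrite /halted; case: n => //= n; case: (step c). Qed.

Lemma read_bits_nth (s : seq 'I_(tm_S M).+3) o :
  (forall i, i < size o -> nth (blank M) s i = sym_of_bool M (nth false o i)) ->
  nth (blank M) s (size o) = blank M -> read_bits s = o.
Proof.
elim: o s => [|b o IH] [|x s] //=.
- by move=> _ ->.
- by move=> /(_ 0 isT) /= /(congr1 val); case: b; rewrite /= inordK.
- move=> h e; have /= -> := h 0 isT; rewrite (IH s) //; last by move=> i; exact: (h i.+1).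
  by case: b {h}; rewrite /= inordK.
Qed.
End Exec.

Section Machine.
Variables (k : nat) (G : frag k).
Local Notation cell := (cell k).

Definition raw_cell (o : option bool) : cell := (o, None, [ffun=> false], false).

(* The stages 0, 1, 2 of the cleaning phase: find the end of the output,
   replace cells by output symbols from right to left, halt. *)
Local Notation cstate := (fstate G + 'I_3)%type.

(** The prescribed start state [0] is a second code of the start of [G]; the simulation only follows
    decoded states. *)
Definition dec_state (i : 'I_#|{: cstate}|.+1) : cstate :=
  if unlift ord0 i is Some j then enum_val j else inl (fstart G).
Definition enc_state (q : cstate) : 'I_#|{: cstate}|.+1 := lift ord0 (enum_rank q).
(** Blank and bits are read as cells with at most an input bit, so the initial tape needs no
    conversion pass. *)
Definition dec_sym (x : 'I_#|{: cell}|.+3) : cell :=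
  match @split 3 #|{: cell}| x with
  | inl j => raw_cell (if val j == 0 then None else Some (val j == 2))
  | inr i => enum_val i
  end.
Definition enc_sym (c : cell) : 'I_#|{: cell}|.+3 := @rshift 3 #|{: cell}| (enum_rank c).
Definition raw_sym b : 'I_#|{: cell}|.+3 := if b then inord 2 else inord 1.

Lemma enc_stateK q : dec_state (enc_state q) = q.
Proof. by rewrite /dec_state /enc_state liftK enum_rankK. Qed.

Lemma enc_symK c : dec_sym (enc_sym c) = c.
Proof. by rewrite /dec_sym /enc_sym (unsplitK (inr (enum_rank c))) enum_rankK. Qed.

Definition exit_state (q : fstate G + bool) : cstate :=
  match q with inl q => inl q | inr _ => inr (@Ordinal 3 0 isT) end.

(** Cells to the right of the output are not erased: the blank written behind its last bit stops
    [read_bits]. *)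
Definition machine : TM := @mkTM #|{: cstate}| #|{: cell}| (fun i x =>
  match dec_state i with
  | inl q => let: (q', a, m) := fdelta q (dec_sym x) in
             Some (enc_state (exit_state q'), enc_sym a, m)
  | inr (@Ordinal _ 0 _) =>
      if (dec_sym x).1.1.2 is None then Some (enc_state (inr (@Ordinal 3 1 isT)), ord0, MoveL)
      else Some (enc_state (inr (@Ordinal 3 0 isT)), x, MoveR)
  | inr (@Ordinal _ 1 _) =>
      if (dec_sym x).1.1.2 is Some b then
        if (dec_sym x).2 then Some (enc_state (inr (@Ordinal 3 2 isT)), raw_sym b, Stay)
        else Some (enc_state (inr (@Ordinal 3 1 isT)), raw_sym b, MoveL)
      else None
  | inr _ => None
  end).

Lemma dec_raw_sym b : dec_sym (sym_of_bool machine b) = raw_cell (Some b).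
Proof.
rewrite /dec_sym /sym_of_bool; case: splitP => j /=; case: b; rewrite /= inordK //.
- by move=> <-.
- by move=> <-.
Qed.

Lemma dec_blank : dec_sym (blank machine) = raw_cell None.
Proof. by rewrite /dec_sym; case: splitP => j //= <-. Qed.

Definition tm_rep (c : config machine) (q : cstate) (h : nat -> _) p :=
  dec_state c.1 = q /\ rep c.2 h p.

Lemma tm_step (c : config machine) q h p q' s m : tm_rep c q h p ->
  tm_delta c.1 (h p) = Some (enc_state q', s, m) ->
  0 < p \/ (if m is MoveL then False else True) ->
  tm_rep (exec 1 c) q' (upd h p s) (mv m p).
Proof.
case: c => [i [[l x] r]] [/= di rp] d pm.
have hx : h p = x by case: rp.
move: rp; rewrite -{}hx /= => rp; move: d => /= ->.
split; first exact: enc_stateK.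
exact: (rep_move s rp pm).
Qed.

(** Blocked and idle steps leave the configuration of [G] unchanged and have no counterpart in the
    machine; hence [m <= n]. *)
Lemma tm_simulates n q f p b f' p' (c : config machine) h :
  iter n (@fstep k G) (q, f, p) = (inr b, f', p') ->
  tm_rep c (exit_state q) h p -> (forall i, dec_sym (h i) = f i) ->
  exists2 m, m <= n & exists2 h', tm_rep (exec m c) (exit_state (inr b)) h' p' &
    forall i, dec_sym (h' i) = f' i.
Proof.
elim: n q f p c h => [|n IH] [q|b'] f p c h.
- by [].
- by case=> _ <- <- rc hf; exists 0 => //; exists h.
- rewrite iterSr [fstep _]/=; case e : (fdelta q (f p)) => [[q1 a] mo].
  case: ifP => pm it rc hf.
    by have [m mn [h' r' d']] := IH _ _ _ _ _ it rc hf; exists m; [apply: leqW | exists h'].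
  have rc1 : tm_rep (exec 1 c) (exit_state q1) (upd h p (enc_sym a)) (mv mo p).
    apply: (tm_step rc); first by rewrite /= rc.1 /= hf e.
    by case: mo pm {e it} => /=; [left; lia | right | right].
  have [|m mn [h' r' d']] := IH _ _ _ _ _ it rc1.
    by move=> i; rewrite /upd; case: eqP; rewrite ?enc_symK.
  by exists m.+1 => //; exists h' => //; rewrite -add1n execD.
- by rewrite iter_exit => -[_ <- <-] rc hf; exists 0 => //; exists h.
Qed.

Lemma tm_cleans (c : config machine) w rs (o : seq bool) h : o != [::] ->
  tm_rep c (inr (@Ordinal 3 0 isT)) h 0 ->
  (forall i, dec_sym (h i) = tape_of k w (rs, o) i) ->
  halted (exec (2 * size o + 1) c) /\ output (exec (2 * size o + 1) c) = o.
Proof.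
move=> o0 rc hf.
have out i : (dec_sym (h i)).1.1.2 = onth o i by rewrite hf.
have scan i : i <= size o -> tm_rep (exec i c) (inr (@Ordinal 3 0 isT)) h i.
  elim: i => // i IH io; rewrite -[X in exec X]addn1 execD -(upd_id h i).
  apply: (tm_step (m := MoveR) (IH (ltnW io))); last by right.
  rewrite /= (IH (ltnW io)).1 /= out.
  by have := onthTE o i; rewrite io; case: onth.
have clean j : j < size o -> exists2 h', tm_rep (exec (size o + 1 + j) c)
    (inr (@Ordinal 3 1 isT)) h' (size o - j.+1) &
    [/\ forall i, i < size o - j -> h' i = h i, h' (size o) = blank machine &
      forall i, size o - j <= i < size o -> h' i = sym_of_bool machine (nth false o i)].
  elim: j => [|j IH] jo.
    exists (upd h (size o) ord0); last first.
      rewrite /upd eqxx; split=> // i; last by lia.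
      by move=> io; rewrite ifF //; lia.
    rewrite addn0 execD subn1; apply: (tm_step (m := MoveL) (scan _ (leqnn _))); last by left.
    by rewrite /= (scan _ (leqnn _)).1 /= out onth_default.
  have [h' r' [h1 h2 h3]] := IH (ltnW jo).
  set p := size o - j.+1 in r'.
  exists (upd h' p (raw_sym (nth false o p))).
    rewrite addnS -addn1 execD (_ : size o - j.+2 = p.-1); last by rewrite /p; lia.
    apply: (tm_step (m := MoveL) r'); last by left; rewrite /p; lia.
    rewrite /= r'.1 /= h1; last by rewrite /p; lia.
    rewrite out (onthE _) (nth_map false) /p; last by lia.
    by rewrite hf /= ifF //; lia.
  rewrite /upd; split=> [i io||i io].
  - by rewrite ifF ?h1 //; lia.
  - by rewrite ifF ?h2 //; lia.
  - by case: eqP => [->|ip] //; rewrite h3 //; lia.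
have so : 0 < size o by case: (o) o0.
have [|h' r' [h1 h2 h3]] := clean (size o).-1; first by lia.
have p0 : size o - (size o).-1.+1 = 0 by lia.
have p1 : size o - (size o).-1 = 1 by lia.
rewrite {}p0 {}p1 in r' h1 h3.
have r1 : tm_rep (exec (2 * size o + 1) c) (inr (@Ordinal 3 2 isT))
    (upd h' 0 (raw_sym (nth false o 0))) 0.
  (* [size o] steps to the end of the output, one to turn, and [size o] to convert its cells, the
     last one at the origin. *)
  rewrite (_ : 2 * size o + 1 = size o + 1 + (size o).-1 + 1); last by lia.
  rewrite execD; apply: (tm_step (m := Stay) r'); last by right.
  rewrite /= r'.1 /= h1 // out (onthE _) (nth_map false) //.
  by rewrite hf /=.
case: (exec _ c) r1 => [i [[l x] r]] [di [hx _ hr]]; split.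
  by rewrite /halted /= (di : dec_state i = _).
rewrite /output; apply: read_bits_nth => [j jo|].
  case: j jo => [|j] jo; first by rewrite /= -hx.
  by rewrite /= -hr /upd add0n /= h3 //; lia.
by case: (size o) so h2 hr => // j _ h2 hr; rewrite /= -hr add0n.
Qed.

End Machine.

Section Compile.
Variables (k : nat) (F : frag k).
Local Notation cell := (cell k).

(** Only the origin changes: elsewhere a raw cell already represents zero registers and empty
    output. *)
Definition prepare : frag k :=
  @Frag k unit tt (fun _ a => (inr true, (a.1.1.1, None, [ffun=> true], true), Stay)).

Local Notation G := (Branch prepare F F).

Lemma runs_prepare w s n b :
  evals w F (nseq k 0, [::]) n b s ->
  exists2 m, m <= 1 + n * (2 * n + 5) & fruns G m (fun i => raw_cell k (onth w i)) b (tape_of k w s).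
Proof.
move=> /(_ 0) [|_ [m l r]]; first by rewrite /within all_nseq orbT.
have [||m' l' r'] := @runs_branch _ prepare F F 1 m true b (fun i => raw_cell k (onth w i))
  (tape_of k w (nseq k 0, [::])) (tape_of k w s); last 1 first.
- by exists m' => //; apply: leq_trans l' _; rewrite leq_add2l.
- rewrite /fruns /=; congr (_, _, _); apply: functional_extensionality => i.
  rewrite /upd; case: eqP => [->|/eqP i0]; apply: cell_ext => //=; rewrite ?onth0n //.
  + by move=> r1; rewrite !ffunE nth_nseq if_same.
  + by move=> r1; rewrite !ffunE nth_nseq if_same eq_sym (negbTE i0).
  + by rewrite (negbTE i0).
- by [].
Qed.

Theorem compile_correct (g : seq bool -> seq bool) (n : nat -> nat) :
  (forall w, exists b rs, evals w F (nseq k 0, [::]) (n (size w)) b (rs, g w)) ->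
  (forall w, g w != [::]) -> poly_bounded n -> poly_computable g.
Proof.
move=> ev g0 pn.
have : poly_bounded (fun x => 1 + n x * (2 * n x + 5) + (2 * n x + 1)).
  by do ?[exact: pn | apply: poly_bounded_add | apply: poly_bounded_mul | apply: poly_bounded_const].
move=> /poly_bounded_standard [c [d cd]]; exists (machine G), c, d => w cf.
have [b [rs e]] := ev w.
have [m m1 r] := runs_prepare e.
(* The memory bound in [evals] also limits the output, hence the time for cleaning. *)
have gn : size (g w) <= n (size w).
  by have [|/andP [_]] := e 0; [rewrite /within all_nseq orbT | ].
have rep0 : tm_rep (init (machine G) w) (exit_state (inl (fstart G)))
   (fun i => nth (blank (machine G)) (map (sym_of_bool (machine G)) w) i) 0.
  split; first by rewrite init_state /dec_state unlift_none.
  by apply: rep_ext (rep_init (machine G) w 0) _ => i; rewrite subn0.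
have [|m' m2 [h' r' d']] := tm_simulates r rep0.
  move=> i; have [iw|iw] := ltnP i (size w).
    by rewrite (nth_map false) // dec_raw_sym (onthE _) (nth_map false).
  by rewrite nth_default ?size_map // dec_blank onth_default.
have [h o] := tm_cleans (g0 w) r' d'.
rewrite /cf -(@subnKC (m' + (2 * size (g w) + 1)) (c * _ + c)); last first.
  apply: leq_trans (cd _); lia.
by rewrite execD execD exec_halted.
Qed.

End Compile.

(** * Loop programs *)

Lemma poly_bounded_comp f g : poly_bounded f -> poly_bounded g -> poly_bounded (f \o g).
Proof.
move=> [c [d hf]] pg; apply: (@poly_bounded_le _ (fun n => c * (g n + 1) ^ d)).
  by move=> n; rewrite addn1; exact: hf.
by do ?[exact: pg | apply: poly_bounded_exp | apply: poly_bounded_add |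
   apply: poly_bounded_mul | apply: poly_bounded_const].
Qed.

Section Programs.
Variable k : nat.

(* [pcost M] bounds the number of operations when all loops run at most [M] times. *)
Record prog := Prog {
  pfrag : frag k;
  pcost : nat -> nat;
  pcostP : poly_bounded pcost }.

Lemma cost_seq (P Q : prog) : poly_bounded (fun M => pcost P M + pcost Q M).
Proof. by apply: poly_bounded_add; exact: pcostP. Qed.

Definition PSeq (P Q : prog) := Prog (Branch (pfrag P) (pfrag Q) (pfrag Q)) (cost_seq P Q).

Definition PAtom (F : frag k) := Prog F (poly_bounded_const 1).

Definition PInc r := PAtom (Inc r).
Definition PReset r := PAtom (Reset r).
Definition PEmit b := PAtom (Emit k b).
Definition PSkip := PAtom (@Visit k xpredT id id id xpredT).

Lemma cost_if (P Q : prog) : poly_bounded (fun M => 1 + (pcost P M + pcost Q M)).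
Proof. by apply: poly_bounded_add; [exact: poly_bounded_const | exact: cost_seq]. Qed.

Definition PIf r (P Q : prog) := Prog (Branch (Input r (Some true)) (pfrag P) (pfrag Q)) (cost_if P Q).

(** [a] is the overhead per round and at the end: a test for a scan; a test plus an increment, or
    finally a reset, for a counted loop. *)
Lemma cost_loop (P : prog) a : poly_bounded (fun M => M * (pcost P M + a) + a).
Proof.
by do ?[exact: pcostP | apply: poly_bounded_add | apply: poly_bounded_mul |
   exact: poly_bounded_const | exact: poly_bounded_id].
Qed.

Definition PScan r (P : prog) := Prog (Until (Input r None) (pfrag P)) (cost_loop P 1).

Definition PFor i x (P : prog) := Prog
  (Branch (Until (Same i x) (Branch (pfrag P) (Inc i) (Inc i))) (Reset i) (Reset i))
  (cost_loop P 2).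

Definition PEach {A} (P : A -> prog) (s : seq A) := foldr (fun x => PSeq (P x)) PSkip s.

Variables (w : seq bool) (M : nat).

Definition emits (P : prog) rs rs' o := forall out,
  exists b, evals w (pfrag P) (rs, out) (pcost P M) b (rs', out ++ o).

Lemma emits_eq P rs rs1 rs' o o' : emits P rs rs1 o -> rs1 = rs' -> o = o' -> emits P rs rs' o'.
Proof. by move=> ? <- <-. Qed.

Lemma emits_seq P Q rs rs1 rs2 o1 o2 :
  emits P rs rs1 o1 -> emits Q rs1 rs2 o2 -> emits (PSeq P Q) rs rs2 (o1 ++ o2).
Proof.
move=> e1 e2 out; have [b1 h1] := e1 out; have [b2 h2] := e2 (out ++ o1).
by exists b2; rewrite catA; apply: evals_branch h1 _; case: b1.
Qed.

Lemma emits_inc r rs : emits (PInc r) rs (set_nth 0 rs r (nth 0 rs r).+1) [::].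
Proof. by move=> out; rewrite cats0; exists true; apply: (@evals_inc k w r (rs, out)). Qed.

Lemma emits_reset r rs : emits (PReset r) rs (set_nth 0 rs r 0) [::].
Proof. by move=> out; rewrite cats0; exists true; apply: (@evals_reset k w r (rs, out)). Qed.

Lemma emits_bit b rs : emits (PEmit b) rs rs [:: b].
Proof. by move=> out; rewrite cats1; exists true; apply: (@evals_emit k w b (rs, out)). Qed.

Lemma emits_skip rs : emits PSkip rs rs [::].
Proof.
move=> out; rewrite cats0; exists true.
apply: (@evals_visit k w xpredT id id id xpredT (rs, out) (rs, out) 0) => // [B wB|i].
  by split=> //; apply: within_le wB.
by rewrite !if_same.
Qed.

Lemma emits_if (r : 'I_k) P Q rs rs' o :
  (onth w (nth 0 rs r) = Some true -> emits P rs rs' o) ->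
  (onth w (nth 0 rs r) <> Some true -> emits Q rs rs' o) -> emits (PIf r P Q) rs rs' o.
Proof.
move=> eP eQ out; have := @evals_input k w r (Some true) (rs, out).
case: eqP => /= [/eP|/eQ] /(_ out) [b h] t; exists b;
  apply: evals_le (evals_branch t h); rewrite /=; lia.
Qed.

Lemma emits_each A (P : A -> prog) (s : seq A) rs o :
  (forall x, emits (P x) rs rs (o x)) -> emits (PEach P s) rs rs (flatten (map o s)).
Proof.
by move=> h; elim: s => [|x s IH] /=; [exact: emits_skip | apply: emits_seq IH].
Qed.

Lemma emits_scan (r : 'I_k) P m (R : nat -> seq nat) :
  m = size w -> m <= M -> (forall t, t <= m -> nth 0 (R t) r = t) ->
  (forall t, t < m -> emits P (R t) (R t.+1) [::]) -> emits (PScan r P) (R 0) (R m) [::].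
Proof.
move=> mw mM rt body out; rewrite cats0.
suff H j : j <= m -> exists b, evals w (pfrag (PScan r P)) (R (m - j), out) (j * (pcost P M + 1) + 1) b (R m, out).
  have [b h] := H m (leqnn m); rewrite subnn in h; exists b; apply: evals_le h.
  by rewrite leq_add2r leq_mul2r mM orbT.
elim: j => [_|j IH jm].
  exists true; rewrite subn0 mul0n; apply: evals_until_stop.
  have := @evals_input k w r None (R m, out); rewrite /= rt // onth_default ?eqxx //; lia.
have [b h] := IH (ltnW jm); have jl : m - j.+1 < m by lia.
have [b' h'] := body _ jl out; rewrite cats0 in h'; exists b.
have := @evals_input k w r None (R (m - j.+1), out); rewrite /= rt; last by lia.
have := onthTE w (m - j.+1); rewrite -mw jl; case: onth => //= x _ t.
rewrite (_ : (m - j.+1).+1 = m - j) in h'; last by lia.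
by apply: evals_le (evals_until_go t h' h); rewrite mulSn; lia.
Qed.

(** [R t] holds the registers before round [t], [R' t] those after its body and before the increment
    of [i]. *)
Lemma emits_for (i x : 'I_k) P m (R R' : nat -> seq nat) (o : nat -> seq bool) :
  m <= M ->
  (forall t, t <= m -> nth 0 (R t) i = t) -> (forall t, t <= m -> nth 0 (R t) x = m) ->
  (forall t, t < m -> emits P (R t) (R' t) (o t)) ->
  (forall t, t < m -> set_nth 0 (R' t) i (nth 0 (R' t) i).+1 = R t.+1) ->
  emits (PFor i x P) (R 0) (set_nth 0 (R m) i 0) (flatten (map o (iota 0 m))).
Proof.
move=> mM ri rx body next out.
suff H j : j <= m -> forall out, exists b,
    evals w (Until (Same i x) (Branch (pfrag P) (Inc i) (Inc i))) (R (m - j), out)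
    (j * (pcost P M + 2) + 1) b (R m, out ++ flatten (map o (iota (m - j) j))).
  have [b h] := H m (leqnn m) out; rewrite subnn in h.
  have := @evals_reset k w i (R m, out ++ flatten (map o (iota 0 m))).
  set s := (set_nth _ _ _ _, _) => /= r; exists true.
  apply: (@evals_le _ _ _ _ (m * (pcost P M + 2) + 1 + 1)).
    by rewrite -addnA leq_add2r leq_mul2r mM orbT.
  by apply: evals_branch h _; case: b.
elim: j => [_ out1|j IH jm out1].
  exists true; rewrite subn0 mul0n cats0; apply: evals_until_stop.
  by have := @evals_same k w i x (R m, out1); rewrite /= ri // rx // eqxx.
have jl : m - j.+1 < m by lia.
have [b' h'] := body _ jl out1.
have [b h] := IH (ltnW jm) (out1 ++ o (m - j.+1)); exists b.
have := @evals_same k w i x (R (m - j.+1), out1); rewrite /= ri 1?ltnW // rx 1?ltnW // gtn_eqF // => t.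
have hi := @evals_inc k w i (R' (m - j.+1), out1 ++ o (m - j.+1)).
rewrite /= next // (_ : (m - j.+1).+1 = m - j) in hi *; last by lia.
have h2 : evals w (Branch (pfrag P) (Inc i) (Inc i)) (R (m - j.+1), out1)
    (pcost P M + 1) true (R (m - j), out1 ++ o (m - j.+1)).
  by apply: evals_branch h' _; case: b'.
rewrite catA; apply: evals_le (evals_until_go t h2 h); rewrite mulSn; lia.
Qed.

Lemma emits_bits bs rs : emits (PEach PEmit bs) rs rs bs.
Proof.
have := emits_each bs (fun b => emits_bit b rs).
by rewrite -[map _ bs]/(map (fun b => [:: b]) bs) flatten_seq1 ?map_id.
Qed.

Definition PAdd r c := PEach (fun=> PInc r) (iota 0 c).

Lemma emits_add (r : 'I_k) c rs : r < size rs ->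
  emits (PAdd r c) rs (set_nth 0 rs r (nth 0 rs r + c)) [::].
Proof.
rewrite /PAdd => rs1.
suff H a : emits (PEach (fun=> PInc r) (iota a c)) rs (set_nth 0 rs r (nth 0 rs r + c)) [::] by [].
elim: c a rs rs1 => [|c IH] a rs rs1 /=.
  apply: emits_eq (emits_skip rs) _ _ => //; rewrite addn0.
  apply: (@eq_from_nth _ 0) => [|i ir].
    by rewrite size_set_nth; lia.
  by rewrite nth_set_nth /=; case: (i =P r :> nat) => [->|].
have h := IH a.+1 (set_nth 0 rs r (nth 0 rs r).+1).
apply: emits_eq (emits_seq (emits_inc r rs) (h _)) _ _ => //.
  by rewrite size_set_nth; lia.
by rewrite set_set_nth eqxx nth_set_nth /= eqxx addSnnS.
Qed.

End Programs.

(** * Printing the instance *)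

(* Besides the sizes, there are the index rs of the current cell, the loop counters ri, rl, rj
   (0 outside their loops) and two scratch registers. *)
Local Notation reg i := (@Ordinal 13 i isT).
Local Notation rn := (reg 0).
Local Notation rB := (reg 1).
Local Notation rN := (reg 2).
Local Notation rT := (reg 3).
Local Notation rV := (reg 4).
Local Notation rZ := (reg 5).
Local Notation rL := (reg 6).
Local Notation rs := (reg 7).
Local Notation ri := (reg 8).
Local Notation rl := (reg 9).
Local Notation rj := (reg 10).
Local Notation rX := (reg 11).
Local Notation rY := (reg 12).

Lemma flatten_nseq_map (A : Type) (x : A) c m : flatten [seq nseq c x | _ <- iota 0 m] = nseq (m * c) x.
Proof. by elim: m 0 => //= m IH a; rewrite IH mulSn nseqD. Qed.

Section Emission.
Variables (D : eqType) (forbidden : seq (D * D * D * D)).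
Local Notation K := (size forbidden).

Definition ones c : prog 13 := PEach (PEmit 13) (nseq c true).

Definition number (bo : bool * nat) : prog 13 :=
  PSeq (PFor rj rs (ones K))
  (PSeq (if bo.1 then PFor rj rV (ones K) else PSkip 13)
        (PEach (PEmit 13) (nseq bo.2 true ++ [:: false]))).

Definition route_prog v : prog 13 :=
  PSeq (PEach (PEmit 13) (enc_nat (size (template forbidden v)))) (PEach number (template forbidden v)).

Definition cell_prog (dom : seq D) : prog 13 :=
  PSeq (PSeq (PEach (PEmit 13) (enc_nat (size dom))) (PEach route_prog dom)) (PInc rs).

Definition triple := [seq (true, 2 * K + j) | j <- iota 0 K].

Definition count_prog x a c : prog 13 :=
  PSeq (PFor ri x (ones a)) (PEach (PEmit 13) (nseq c true ++ [:: false])).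

(** [L] is printed three times: as [m], as [k], and as the length prefix of the list of resources.
    The target loop borrows [rs], which is then reset. *)
Definition header_prog : prog 13 :=
  PSeq (PFor ri rL (ones K)) (PSeq (count_prog rV K (2 * K)) (PSeq (count_prog rZ K 0)
  (PSeq (PFor ri rZ (PSeq (PEach number triple) (PInc rs))) (PSeq (PReset rs)
  (PSeq (count_prog rL 1 0) (PSeq (count_prog rL 1 0) (count_prog rL 1 0))))))).

Section Sizes.
Variables (w : seq bool) (M n B N T V Z L : nat).
Hypothesis bounds : [/\ n <= M, B <= M, T <= M & V <= M] /\ [/\ Z <= M & L <= M].
Hypothesis LE : L = Z + V + 2.

Local Notation st s i l j := [:: n; B; N; T; V; Z; L; s; i; l; j; 0; 0].
Local Notation emits := (@emits 13 w M).

Lemma emits_ones c R : emits (ones c) R R (nseq c true).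
Proof. exact: emits_bits. Qed.

Lemma emits_loop_j (x : 'I_13) m P o s i l : m <= M -> nth 0 (st s i l 0) x = m -> x != rj ->
  (forall t, t < m -> emits P (st s i l t) (st s i l t) (o t)) ->
  emits (PFor rj x P) (st s i l 0) (st s i l 0) (flatten (map o (iota 0 m))).
Proof.
move=> mM xm xj body.
apply: emits_eq (@emits_for 13 w M rj x P m (fun t => st s i l t) (fun t => st s i l t) o mM _ _ _ _) _ _
  => //= t tm.
move: xm xj; case: x => x xk /=; rewrite -(inj_eq val_inj) /=.
by do 11?[case: x xk => [|x] xk //=].
Qed.

Lemma emits_loop_i (x : 'I_13) m P o s0 s d : m <= M -> x \in [:: rn; rB; rT; rV; rZ; rL] ->
  nth 0 (st 0 0 0 0) x = m -> (forall t, s t = s0 + t * d) ->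
  (forall t, t < m -> emits P (st (s t) t 0 0) (st (s t.+1) t 0 0) (o t)) ->
  emits (PFor ri x P) (st s0 0 0 0) (st (s m) 0 0 0) (flatten (map o (iota 0 m))).
Proof.
move=> mM xin xm sE body; have <- : s 0 = s0 by rewrite sE mul0n addn0.
apply: emits_eq (@emits_for 13 w M ri x P m (fun t => st (s t) t 0 0) (fun t => st (s t.+1) t 0 0) o mM _ _ _ _) _ _
  => //= t tm.
by move: xin xm; rewrite !inE => /or4P [|||/or3P []] /eqP -> /=.
Qed.

Lemma emits_loop_l (x : 'I_13) m P o s0 s i d : m <= M -> x \in [:: rn; rB; rT; rV; rZ; rL] ->
  nth 0 (st 0 0 0 0) x = m -> (forall t, s t = s0 + t * d) ->
  (forall t, t < m -> emits P (st (s t) i t 0) (st (s t.+1) i t 0) (o t)) ->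
  emits (PFor rl x P) (st s0 i 0 0) (st (s m) i 0 0) (flatten (map o (iota 0 m))).
Proof.
move=> mM xin xm sE body; have <- : s 0 = s0 by rewrite sE mul0n addn0.
apply: emits_eq (@emits_for 13 w M rl x P m (fun t => st (s t) i t 0) (fun t => st (s t.+1) i t 0) o mM _ _ _ _) _ _
  => //= t tm.
by move: xin xm; rewrite !inE => /or4P [|||/or3P []] /eqP -> /=.
Qed.

Lemma emits_number bo s i l : s <= M ->
  emits (number bo) (st s i l 0) (st s i l 0) (enc_nat (target forbidden V s bo)).
Proof.
move=> sM; have vM : V <= M by case: bounds => -[].
have -> : enc_nat (target forbidden V s bo) = nseq (s * K) true ++
    (nseq (if bo.1 then V * K else 0) true ++ (nseq bo.2 true ++ [:: false])).
  by rewrite /enc_nat /target !nseqD -!catA.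
apply: emits_seq.
  rewrite -flatten_nseq_map; apply: emits_loop_j => // t _; exact: emits_ones.
apply: emits_seq; last exact: emits_bits.
case: bo.1; last exact: emits_skip.
rewrite -flatten_nseq_map; apply: emits_loop_j => // t _; exact: emits_ones.
Qed.

Definition cell_code s dom := enc_list (enc_list enc_nat) [seq route forbidden V s v | v <- dom].

Fixpoint cells_code s ds :=
  if ds is d :: ds' then cell_code s d ++ cells_code s.+1 ds' else [::].

Lemma cells_code_cat s d1 d2 :
  cells_code s (d1 ++ d2) = cells_code s d1 ++ cells_code (s + size d1) d2.
Proof.
elim: d1 s => [|d d1 IH] s /=; first by rewrite addn0.
by rewrite IH catA addSnnS.
Qed.

Lemma cells_code_map s ds :
  cells_code s ds = flatten [seq cell_code (s + r) (nth [::] ds r) | r <- iota 0 (size ds)].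
Proof.
elim: ds s => //= d ds IH s; rewrite addn0 IH (iotaDl 1) -map_comp; congr (_ ++ flatten _).
by apply: eq_map => r /=; rewrite addSnnS.
Qed.

(** The start [s] is arbitrary, so concatenating programs concatenates lists of domains; the bound
    by [L] keeps the loops over [rs] within [M]. *)
Definition writes i l P ds := forall s, s + size ds <= L ->
  emits P (st s i l 0) (st (s + size ds) i l 0) (cells_code s ds).

Lemma writes_cell dom i l : writes i l (cell_prog dom) [:: dom].
Proof.
move=> s sL; have sM : s <= M by case: bounds => _ [_]; rewrite /= in sL; lia.
rewrite /= addn1 cats0 /cell_code /enc_list size_map -[X in emits _ _ _ X]cats0.
apply: (emits_seq _ (emits_inc _ _ rs (st s i l 0))).
apply: emits_seq; first exact: emits_bits.
rewrite -map_comp; apply: emits_each => v /=; rewrite /enc_list size_map.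
apply: emits_seq; first exact: emits_bits.
by rewrite -map_comp; apply: emits_each => bo; exact: emits_number.
Qed.

Lemma writes_seq i l P Q d1 d2 : writes i l P d1 -> writes i l Q d2 -> writes i l (PSeq P Q) (d1 ++ d2).
Proof.
move=> h1 h2 s; rewrite size_cat cells_code_cat addnA => sL.
by apply: emits_seq (h1 s _) (h2 _ sL); apply: leq_trans (leq_addr _ _) sL.
Qed.

Lemma cells_code_flatten s d m (ds : nat -> seq (seq D)) : (forall t, size (ds t) = d) ->
  cells_code s (flatten (map ds (iota 0 m))) =
  flatten [seq cells_code (s + t * d) (ds t) | t <- iota 0 m].
Proof.
move=> dE; elim: m ds dE s => // m IH ds dE s; rewrite /= cells_code_cat mul0n addn0 dE.
rewrite (iotaDl 1) -!map_comp (IH (fun t => ds (1 + t))) //; congr (_ ++ flatten _).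
by apply: eq_map => t /=; rewrite mulSn addnA.
Qed.

Lemma size_flatten_const d m (ds : nat -> seq (seq D)) : (forall t, size (ds t) = d) ->
  size (flatten (map ds (iota 0 m))) = m * d.
Proof.
by move=> dE; elim: m 0 => //= m IH a; rewrite size_cat IH dE mulSn.
Qed.

Lemma writes_loop_l x m P i d ds : m <= M -> x \in [:: rn; rB; rT; rV; rZ; rL] ->
  nth 0 (st 0 0 0 0) x = m -> (forall t, size (ds t) = d) ->
  (forall t, t < m -> writes i t P (ds t)) -> writes i 0 (PFor rl x P) (flatten (map ds (iota 0 m))).
Proof.
move=> mM xin xm dE body s.
rewrite (@cells_code_flatten _ d) // (@size_flatten_const d) // => sL.
apply: (@emits_loop_l x m P _ s (fun t => s + t * d) i d) => // t tm.
have := body t tm (s + t * d); rewrite dE -addnA -mulSnr; apply.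
by apply: leq_trans sL; rewrite leq_add2l leq_mul2r tm orbT.
Qed.

Lemma writes_loop_i x m P d ds : m <= M -> x \in [:: rn; rB; rT; rV; rZ; rL] ->
  nth 0 (st 0 0 0 0) x = m -> (forall t, size (ds t) = d) ->
  (forall t, t < m -> writes t 0 P (ds t)) -> writes 0 0 (PFor ri x P) (flatten (map ds (iota 0 m))).
Proof.
move=> mM xin xm dE body s.
rewrite (@cells_code_flatten _ d) // (@size_flatten_const d) // => sL.
apply: (@emits_loop_i x m P _ s (fun t => s + t * d) d) => // t tm.
have := body t tm (s + t * d); rewrite dE -addnA -mulSnr; apply.
by apply: leq_trans sL; rewrite leq_add2l leq_mul2r tm orbT.
Qed.

Lemma emits_count x m a c : m <= M -> x \in [:: rn; rB; rT; rV; rZ; rL] ->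
  nth 0 (st 0 0 0 0) x = m ->
  emits (count_prog x a c) (st 0 0 0 0) (st 0 0 0 0) (enc_nat (m * a + c)).
Proof.
move=> mM xin xm; rewrite /enc_nat nseqD -catA; apply: emits_seq; last exact: emits_bits.
rewrite -flatten_nseq_map; apply: (@emits_loop_i x m _ _ 0 (fun=> 0) 0) => // [t|t _].
  by rewrite muln0.
exact: emits_ones.
Qed.

Lemma emits_header : emits header_prog (st 0 0 0 0) (st 0 0 0 0)
  (enc_nat (csp_ntargets forbidden V Z) ++ enc_list enc_nat (csp_targets forbidden V Z) ++
   enc_nat (Z + V + 2) ++ enc_nat (Z + V + 2) ++ enc_nat (Z + V + 2)).
Proof.
case: bounds => -[nM BM TM VM] [ZM LM].
have -> : enc_nat (csp_ntargets forbidden V Z) = nseq (L * K) true ++ enc_nat (V * K + 2 * K).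
  rewrite /enc_nat catA -nseqD; congr (nseq _ _ ++ _).
  by rewrite /csp_ntargets LE; lia.
rewrite -catA; apply: emits_seq.
  rewrite -flatten_nseq_map; apply: (@emits_loop_i rL L _ _ 0 (fun=> 0) 0) => // [t|t _].
    by rewrite muln0.
  exact: emits_ones.
apply: emits_seq; first exact: emits_count.
rewrite /enc_list -catA.
have -> : size (csp_targets forbidden V Z) = Z * K + 0.
  rewrite addn0 /csp_targets size_flatten /shape -map_comp -[in RHS](size_iota 0 Z).
  by elim: (iota 0 Z) => //= t ts IH; rewrite IH size_map size_iota mulSn.
apply: emits_seq; first exact: emits_count.
have -> : flatten (map enc_nat (csp_targets forbidden V Z)) =
    flatten [seq flatten [seq enc_nat (target forbidden V t bo) | bo <- triple] | t <- iota 0 Z].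
  rewrite /csp_targets; elim: (iota 0 Z) => //= t ts IH.
  by rewrite map_cat flatten_cat IH -!map_comp.
apply: emits_seq.
  apply: (@emits_loop_i rZ Z _ _ 0 (fun t => t) 1) => // [t|t tZ]; first by rewrite muln1.
  rewrite -[X in emits _ _ _ X]cats0; apply: (emits_seq _ (emits_inc _ _ rs (st t t 0 0))).
  apply: emits_each => bo; apply: emits_number; lia.
rewrite -[enc_nat _ ++ _]cat0s; apply: emits_seq; first exact: emits_reset.
rewrite -LE; have hL : emits (count_prog rL 1 0) (st 0 0 0 0) (st 0 0 0 0) (enc_nat L).
  by have := @emits_count rL L 1 0 LM isT erefl; rewrite muln1 addn0.
by apply: (emits_seq hL); apply: (emits_seq hL).
Qed.

End Sizes.
End Emission.

(** * Computing the sizes *)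

Section Prelude.
Variables (w : seq bool) (M : nat).
Local Notation emits := (@emits 13 w M).

Lemma emits_accum (i x y : 'I_13) P d m r : i != x -> i != y -> x != y ->
  i < size r -> y < size r -> nth 0 r i = 0 -> nth 0 r x = m -> m <= M ->
  (forall a t, t < m -> emits P (set_nth 0 (set_nth 0 r y a) i t)
                        (set_nth 0 (set_nth 0 r y (a + d)) i t) [::]) ->
  emits (PFor i x P) r (set_nth 0 r y (nth 0 r y + m * d)) [::].
Proof.
rewrite -!(inj_eq val_inj) /= => ix iy xy si sy i0 xm mM body.
pose R t := set_nth 0 (set_nth 0 r y (nth 0 r y + t * d)) i t.
pose R' t := set_nth 0 (set_nth 0 r y (nth 0 r y + t.+1 * d)) i t.
have sz a b : size (set_nth 0 (set_nth 0 r y a) i b) = size r.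
  by rewrite !size_set_nth; lia.
have R0 : R 0 = r.
  apply: (@eq_from_nth _ 0) => [|q _]; first exact: sz.
  rewrite nth_set_nth /= nth_set_nth /= mul0n addn0.
  case: (q =P i :> nat) => [->|_]; first by rewrite i0.
  by case: (q =P y :> nat) => [->|].
have Rm : set_nth 0 (R m) i 0 = set_nth 0 r y (nth 0 r y + m * d).
  apply: (@eq_from_nth _ 0) => [|q _]; first by rewrite !size_set_nth; lia.
  rewrite !nth_set_nth /= !nth_set_nth /=.
  by case: (q =P i :> nat) => [->|]; rewrite ?(negbTE iy) ?i0 // !nth_set_nth.
rewrite -[in X in emits _ X _]R0 -Rm.
have := @emits_for 13 w M i x P m R R' (fun=> [::]) mM.
rewrite (_ : flatten _ = [::]); last by elim: (iota 0 m).
apply=> [t _|t _|t tm|t _].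
- by rewrite nth_set_nth /= eqxx.
- by rewrite nth_set_nth /= nth_set_nth /= eq_sym (negbTE ix) (negbTE xy).
- by have := body (nth 0 r y + t * d) t tm; rewrite -addnA -mulSnr.
- by rewrite /R' nth_set_nth /= eqxx set_set_nth eqxx.
Qed.

Lemma emits_for_add (i x y : 'I_13) c m r : i != x -> i != y -> x != y ->
  i < size r -> y < size r -> nth 0 r i = 0 -> nth 0 r x = m -> m <= M ->
  emits (PFor i x (PAdd y c)) r (set_nth 0 r y (nth 0 r y + m * c)) [::].
Proof.
move=> ix iy xy si sy i0 xm mM; apply: emits_accum => // a t _.
have iy' : (i == y :> nat) = false by apply: negbTE.
apply: emits_eq (emits_add _ _ _ _) _ _ => //; first by rewrite !size_set_nth; lia.
have yi : (y == i :> nat) = false by rewrite eq_sym.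
rewrite nth_set_nth /= yi nth_set_nth /= eqxx.
by rewrite set_set_nth iy' (set_set_nth _ r y) eqxx.
Qed.

Definition mul_step : prog 13 :=
  PSeq (PFor ri rX (PFor rj rN (PAdd rY 1)))
  (PSeq (PReset rX) (PSeq (PFor ri rY (PAdd rX 1)) (PReset rY))).

Fixpoint pow_prog d : prog 13 := if d is d'.+1 then PSeq mul_step (pow_prog d') else PSkip 13.

(** The bound uses [a.+1] because for [a = 0] the final power does not bound the intermediate
    values. *)
Lemma emits_pow n B a t x d : a <= M -> x * a.+1 ^ d <= M ->
  emits (pow_prog d) [:: n; B; a; t; 0; 0; 0; 0; 0; 0; 0; x; 0]
     [:: n; B; a; t; 0; 0; 0; 0; 0; 0; 0; x * a ^ d; 0] [::].
Proof.
move=> aM; elim: d x => [|d IH] x xM /=.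
  by rewrite expn0 muln1; exact: emits_skip.
have p0 : 0 < a.+1 ^ d by rewrite expn_gt0.
have xaM : x * a.+1 <= M by apply: leq_trans xM; rewrite leq_mul2l expnS leq_pmulr ?orbT.
have xM' : x <= M by apply: leq_trans xaM; rewrite leq_pmulr.
rewrite -[X in emits _ _ _ X]cats0; apply: emits_seq; last first.
  by rewrite expnS mulnA; apply: IH; apply: leq_trans xM; rewrite expnS mulnA leq_mul2r leq_mul2l leqnSn !orbT.
rewrite -[X in emits _ _ _ X]cats0 /mul_step.
apply: (emits_seq (rs1 := [:: n; B; a; t; 0; 0; 0; 0; 0; 0; 0; x; x * a])).
  apply: emits_eq (@emits_accum ri rX rY _ a x _ _ _ _ _ _ _ _ _ _) _ _ => //= b u _.
  apply: emits_eq (@emits_for_add rj rN rY 1 a _ _ _ _ _ _ _ _ _) _ _ => //=.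
  by rewrite muln1.
rewrite -[X in emits _ _ _ X]cats0; apply: emits_seq; first exact: emits_reset.
rewrite -[X in emits _ _ _ X]cats0; apply: emits_seq.
  apply: (@emits_for_add ri rY rX 1 (x * a)) => //=.
  by apply: leq_trans xaM; rewrite leq_mul2l leqnSn orbT.
by apply: emits_eq (emits_reset _ _ _ _) _ _ => //=; rewrite muln1.
Qed.

Definition poly_prog c d : prog 13 :=
  PSeq (PInc rX) (PSeq (pow_prog d)
  (PSeq (PFor ri rX (PAdd rT c)) (PSeq (PReset rX) (PAdd rT c)))).

Lemma emits_nil_seq P Q r r1 r2 : emits P r r1 [::] -> emits Q r1 r2 [::] -> emits (PSeq P Q) r r2 [::].
Proof. by move=> p q; have := emits_seq p q. Qed.

Lemma emits_poly n B a c d : a.+1 ^ d <= M -> a <= M ->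
  emits (poly_prog c d) [:: n; B; a; 0; 0; 0; 0; 0; 0; 0; 0; 0; 0]
     [:: n; B; a; c * a ^ d + c; 0; 0; 0; 0; 0; 0; 0; 0; 0] [::].
Proof.
move=> adM aM; apply: emits_nil_seq; first exact: emits_inc.
apply: emits_nil_seq; first by apply: emits_pow => //; rewrite mul1n.
rewrite mul1n; apply: emits_nil_seq.
  apply: (@emits_for_add ri rX rT c (a ^ d)) => //=.
  by apply: leq_trans adM; case: (d) => // e; rewrite leq_exp2r.
apply: emits_nil_seq; first exact: emits_reset.
by apply: emits_eq (emits_add _ _ _ _) _ _ => //=; rewrite mulnC.
Qed.

(** [poly_prog] reads [rN] and writes [rT], so during its first use these hold [n] and [B]; they are
    reset before receiving their own values. *)
Definition prelude cB dB cT dT : prog 13 :=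
  PSeq (PScan rn (PSeq (PInc rn) (PInc rN))) (PSeq (poly_prog cB dB)
  (PSeq (PFor ri rT (PAdd rB 1)) (PSeq (PReset rT) (PSeq (PReset rN)
  (PSeq (PFor ri rn (PAdd rN 2)) (PSeq (PAdd rN 1) (PSeq (PFor ri rB (PAdd rN 1))
  (PSeq (poly_prog cT dT)
  (PSeq (PFor ri rT (PAdd rV 2)) (PSeq (PAdd rV 3) (PSeq (PFor ri rN (PAdd rV 1))
  (PSeq (PFor ri rT (PSeq (PFor rj rV (PAdd rZ 1)) (PAdd rZ 1)))
  (PSeq (PFor rj rV (PAdd rZ 1)) (PSeq (PAdd rZ 1)
  (PSeq (PFor ri rZ (PAdd rL 1)) (PSeq (PFor ri rV (PAdd rL 1)) (PAdd rL 2))))))))))))))))).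

Lemma emits_prelude cB dB cT dT :
  let n := size w in let B := cB * n ^ dB + cB in let N := 2 * n + 1 + B in
  let T := cT * N ^ dT + cT in let V := tab_V w B T in let Z := tab_Z w B T in
  let L := Z + V + 2 in
  [/\ n.+1 ^ dB <= M, N.+1 ^ dT <= M, T <= M & N <= M] -> L <= M ->
  emits (prelude cB dB cT dT) (nseq 13 0) [:: n; B; N; T; V; Z; L; 0; 0; 0; 0; 0; 0] [::].
Proof.
move=> n B N T V Z L [nM NM TM NM'] LM.
have [ZM VM] : Z <= M /\ V <= M by rewrite /L in LM; lia.
have [n_M B_M] : n <= M /\ B <= M by rewrite /N in NM'; lia.
apply: emits_nil_seq.
  apply: (@emits_scan 13 w M rn _ n (fun t => [:: t; 0; t; 0; 0; 0; 0; 0; 0; 0; 0; 0; 0])) => // t _.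
  by apply: emits_nil_seq; [exact: emits_inc | exact: emits_inc].
apply: emits_nil_seq; first exact: emits_poly.
apply: emits_nil_seq; first by apply: (@emits_for_add ri rT rB 1 B).
apply: emits_nil_seq; first exact: emits_reset.
apply: emits_nil_seq; first exact: emits_reset.
apply: emits_nil_seq; first by apply: (@emits_for_add ri rn rN 2 n).
apply: emits_nil_seq; first exact: emits_add.
apply: emits_nil_seq; first by apply: (@emits_for_add ri rB rN 1 B) => //=; rewrite muln1.
rewrite /= !muln1 !add0n (mulnC n) -/N.
apply: emits_nil_seq; first exact: emits_poly.
apply: emits_nil_seq; first by apply: (@emits_for_add ri rT rV 2 T).
apply: emits_nil_seq; first exact: emits_add.
apply: emits_nil_seq; first by apply: (@emits_for_add ri rN rV 1 N).
rewrite /= !muln1 !add0n (mulnC T) -/V.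
apply: emits_nil_seq.
  apply: (@emits_accum ri rT rZ _ V.+1 T) => //= a t _; apply: emits_nil_seq.
    by apply: (@emits_for_add rj rV rZ 1 V).
  apply: emits_eq (emits_add _ _ _ _) _ _ => //=.
  by rewrite muln1 addn1 -addnS.
apply: emits_nil_seq; first by apply: (@emits_for_add rj rV rZ 1 V).
apply: emits_nil_seq; first exact: emits_add.
have ZE : 0 + T * V.+1 + V * 1 + 1 = Z by rewrite /Z /tab_Z mulnS; lia.
rewrite /= ZE; apply: emits_nil_seq; first by apply: (@emits_for_add ri rZ rL 1 Z).
apply: emits_nil_seq; first by apply: (@emits_for_add ri rV rL 1 V).
by apply: emits_eq (emits_add _ _ _ _) _ _ => //=; rewrite !muln1.
Qed.

End Prelude.

(** * The reduction *)

Section Reduction.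
Variables (MV : TM) (cB dB cT dT : nat).
Local Notation D := (symbol MV).
Local Notation Q := (forbidden MV).

Local Notation cell_p := (cell_prog Q).

Definition body_prog : prog 13 :=
  PSeq (PFor ri rT (cell_p [:: plain (blank MV)])) (PSeq (cell_p [:: plain (blank MV)])
  (PSeq (cell_p [:: inl (blank MV, Some None)])
  (PSeq (PFor ri rn (PSeq (cell_p (input_dom MV true))
           (PIf ri (cell_p (input_dom MV true)) (cell_p (input_dom MV false)))))
  (PSeq (cell_p (input_dom MV false))
  (PSeq (PFor ri rB (cell_p (witness_dom MV)))
  (PSeq (PFor ri rT (cell_p [:: plain (blank MV)]))
  (PSeq (cell_p [:: plain (blank MV)])
  (PSeq (cell_p [:: plain (blank MV)])
  (PSeq (cell_p [:: plain (blank MV)])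
  (PSeq (PFor ri rT (PSeq (PFor rl rV (cell_p (enum {: D}))) (cell_p (enum {: D}))))
  (PSeq (PFor ri rV (cell_p (accept_dom MV))) (cell_p (accept_dom MV))))))))))))).

Definition reduction_prog := PSeq (prelude cB dB cT dT) (PSeq (header_prog Q) body_prog).

Definition B_of n := cB * n ^ dB + cB.
Definition N_of n := 2 * n + 1 + B_of n.
Definition T_of n := cT * N_of n ^ dT + cT.

Definition reduction w :=
  csp_enc Q (tab_V w (B_of (size w)) (T_of (size w)))
    (tab_Z w (B_of (size w)) (T_of (size w)))
    (doms MV w (B_of (size w)) (T_of (size w))).

Section Run.
Variables (w : seq bool) (M : nat).
Local Notation n := (size w).
Local Notation B := (B_of n).
Local Notation N := (N_of n).
Local Notation T := (T_of n).
Local Notation V := (tab_V w B T).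
Local Notation Z := (tab_Z w B T).
Local Notation L := (Z + V + 2).
Local Notation st s i l j := [:: n; B; N; T; V; Z; L; s; i; l; j; 0; 0].
Local Notation emits := (@emits 13 w M).
Hypothesis LM : L <= M.

Let bounds : [/\ n <= M, B <= M, T <= M & V <= M] /\ [/\ Z <= M & L <= M].
Proof.
have [VM ZM] : V <= M /\ Z <= M by move: LM; lia.
by move: VM; rewrite {1 3}/tab_V /N_of; split=> //; split; lia.
Qed.

Local Notation writes := (writes Q w M n B N T V Z L).

Lemma writes_cst i l dom : writes i l (cell_p dom) [:: dom].
Proof. exact: writes_cell. Qed.

Lemma writes_repeat x m P dom : m <= M -> x \in [:: rn; rB; rT; rV; rZ; rL] ->
  nth 0 (st 0 0 0 0) x = m -> (forall t, writes t 0 P [:: dom]) ->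
  writes 0 0 (PFor ri x P) (nseq m dom).
Proof.
move=> mM xin xm h; rewrite -[m in nseq m]muln1 -flatten_nseq_map.
by apply: (@writes_loop_i _ _ _ _ _ _ _ _ _ _ _ x m P 1).
Qed.

Lemma flatten_pairs : flatten [seq [:: input_dom MV true; input_dom MV (nth false w t)] | t <- iota 0 n] ++
  [:: input_dom MV false] = map (input_dom MV) (pair_enc w [::]).
Proof.
rewrite /pair_enc map_cat /=; congr (_ ++ _).
elim: w => //= b u IH; rewrite (iotaDl 1) -map_comp -IH; congr [:: _, _ & _].
Qed.

Lemma emits_body : emits body_prog (st 0 0 0 0) (st L 0 0 0) (cells_code Q V 0 (doms MV w B T)).
Proof.
case: (bounds) => -[nM BM TM VM] [ZM _].
have H : writes 0 0 body_prog (doms MV w B T).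
  have -> : doms MV w B T =
    nseq T [:: plain (blank MV)] ++ [:: [:: plain (blank MV)]] ++
    [:: [:: inl (blank MV, Some None)]] ++
    flatten [seq [:: input_dom MV true; input_dom MV (nth false w t)] | t <- iota 0 n] ++
    [:: input_dom MV false] ++ nseq B (witness_dom MV) ++
    nseq T [:: plain (blank MV)] ++ [:: [:: plain (blank MV)]] ++ [:: [:: plain (blank MV)]] ++
    [:: [:: plain (blank MV)]] ++ flatten [seq nseq V (enum {: D}) ++ [:: enum {: D}] | _ <- iota 0 T] ++
    nseq V (accept_dom MV) ++ [:: accept_dom MV].
    have nS (A : Type) c (x : A) : nseq c.+1 x = nseq c x ++ [:: x] by rewrite -addn1 nseqD.
    rewrite /doms -flatten_pairs !nS !mulSn (_ : T + V * T = T * V.+1); last by rewrite mulnS mulnC.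
    have -> : flatten [seq nseq V (enum {: D}) ++ [:: enum {: D}] | _ <- iota 0 T] = nseq (T * V.+1) (enum {: D}).
      by rewrite -nS flatten_nseq_map.
    by rewrite -!catA.
  apply: writes_seq; first by apply: writes_repeat => // t; exact: writes_cst.
  apply: writes_seq; first exact: writes_cst.
  apply: writes_seq; first exact: writes_cst.
  apply: writes_seq.
    apply: (@writes_loop_i _ _ _ _ _ _ _ _ _ _ _ rn n _ 2) => // t tn.
    rewrite -[[:: _; _]]/([:: input_dom MV true] ++ [:: _]); apply: writes_seq; first exact: writes_cst.
    move=> s sL; apply: emits_if => /=; rewrite (onthE _) (nth_map false) // => e.
      by case: e => ->; apply: writes_cst.
    have -> : nth false w t = false by case: (nth _ _ _) e.
    by apply: writes_cst.
  apply: writes_seq; first exact: writes_cst.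
  apply: writes_seq; first by apply: writes_repeat => // t; exact: writes_cst.
  apply: writes_seq; first by apply: writes_repeat => // t; exact: writes_cst.
  apply: writes_seq; first exact: writes_cst.
  apply: writes_seq; first exact: writes_cst.
  apply: writes_seq; first exact: writes_cst.
  apply: writes_seq.
    apply: (@writes_loop_i _ _ _ _ _ _ _ _ _ _ _ rT T _ V.+1) => // [t|t _].
      by rewrite size_cat size_nseq addn1.
    apply: writes_seq; last exact: writes_cst.
    rewrite -[V in nseq V]muln1 -flatten_nseq_map.
    by apply: (@writes_loop_l _ _ _ _ _ _ _ _ _ _ _ rV V _ t 1) => // u _; exact: writes_cst.
  apply: writes_seq; last exact: writes_cst.
  by apply: writes_repeat => // t; exact: writes_cst.
have := H 0; rewrite size_doms add0n; exact.
Qed.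

Lemma emits_reduction : n.+1 ^ dB <= M -> N.+1 ^ dT <= M ->
  emits reduction_prog (nseq 13 0) (st L 0 0 0) (reduction w).
Proof.
move=> nM NM; case: (bounds) => -[n_M BM TM VM] [ZM _].
have -> : reduction w = [::] ++ ((enc_nat (csp_ntargets Q V Z) ++ enc_list enc_nat (csp_targets Q V Z) ++
   enc_nat L ++ enc_nat L ++ enc_nat L) ++ cells_code Q V 0 (doms MV w B T)).
  rewrite /reduction /csp_enc /enc_inst cat0s -!catA; do 4!congr (_ ++ _).
  rewrite {1}/enc_list /csp_routes size_map size_iota cells_code_map size_doms -map_comp.
  by rewrite [enc_nat L]/enc_nat -!catA.
apply: emits_seq.
  by apply: emits_prelude => //; split=> //; apply: leq_trans VM; rewrite /tab_V leq_addl.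
by apply: (emits_seq (emits_header _ _ _ bounds erefl)); exact: emits_body.
Qed.
End Run.

Lemma reduction_computable : poly_computable reduction.
Proof.
pose Vb x := 2 * T_of x + 3 + (2 * x + 1 + B_of x).
pose Lb x := (Vb x).+1 * (T_of x).+1 + Vb x + 2.
(* [Lb] bounds all loops over sizes, the two powers those inside [poly_prog]. *)
pose Mb x := Lb x + (x.+1 ^ dB + (N_of x).+1 ^ dT).
have pc := poly_bounded_const; have pi := poly_bounded_id.
have pB : poly_bounded B_of := poly_bounded_add (poly_bounded_mul (pc cB) (poly_bounded_exp dB pi)) (pc cB).
have p1 f : poly_bounded f -> poly_bounded (fun x => (f x).+1).
  by move=> pf; apply: poly_bounded_le (poly_bounded_add pf (pc 1)) => x; rewrite addn1.
have pN : poly_bounded N_of := poly_bounded_add (poly_bounded_add (poly_bounded_mul (pc 2) pi) (pc 1)) pB.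
have pT : poly_bounded T_of := poly_bounded_add (poly_bounded_mul (pc cT) (poly_bounded_exp dT pN)) (pc cT).
have pV : poly_bounded Vb := poly_bounded_add (poly_bounded_add (poly_bounded_mul (pc 2) pT) (pc 3)) pN.
have pL : poly_bounded Lb := poly_bounded_add (poly_bounded_add (poly_bounded_mul (p1 _ pV) (p1 _ pT)) pV) (pc 2).
have pM : poly_bounded Mb := poly_bounded_add pL
  (poly_bounded_add (poly_bounded_exp dB (p1 _ pi)) (poly_bounded_exp dT (p1 _ pN))).
apply: (@compile_correct 13 (pfrag reduction_prog) _ (pcost reduction_prog \o Mb)) => [w|w|].
- have h1 : tab_Z w (B_of (size w)) (T_of (size w)) + tab_V w (B_of (size w)) (T_of (size w)) + 2 <= Mb (size w).
    exact: leq_addr.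
  have h2 : (size w).+1 ^ dB <= Mb (size w) by rewrite /Mb; lia.
  have h3 : (N_of (size w)).+1 ^ dT <= Mb (size w) by rewrite /Mb; lia.
  by have [b h] := emits_reduction h1 h2 h3 [::]; exists b; eexists; exact: h.
- by rewrite /reduction /csp_enc /enc_inst /enc_nat; case: (csp_ntargets _ _ _).
- by apply: poly_bounded_comp pM; exact: pcostP.
Qed.

End Reduction.

Theorem theorem5 : NP_hard jcr_lang.
Proof.
move=> L' [Vf [[MV [cT [dT dec]]] [cB [dB wit]]]].
exists (reduction MV cB dB cT dT); split; first exact: reduction_computable.
move=> w; rewrite wit jcr_lang_csp tableau_correct.
have acc y : size y <= B_of cB dB (size w) ->
    (let: (_, (_, h, _)) := exec (T_of cB dB cT dT (size w)) (init MV (pair_enc w y)) in val h = 2)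
    <-> Vf (pair_enc w y).
  move=> yB; have /= [hlt out] := dec (pair_enc w y).
  (* The time bound for this [y] is at most the one at the largest length [N_of], and the halted
     configuration persists until then. *)
  rewrite -(@subnKC (cT * size (pair_enc w y) ^ dT + cT) (T_of _ _ _ _ _)); last first.
    rewrite leq_add2r leq_mul2l; apply/orP; right.
    have : size (pair_enc w y) <= N_of cB dB (size w) by rewrite size_pair_enc leq_add2l.
    by case: (dT) => // e; rewrite leq_exp2r.
  rewrite execD exec_halted //; move: out.
  case: (exec _ _) => [q [[l h] r]] /=.
  case: (\val h =P 1) => [->|_]; first by case=> [[]|[_ nV]].
  by case: (\val h =P 2) => [->|_]; case=> [[]|[]].
split=> [[y [yB Vy]]|[y yB /(acc y yB) Vy]]; exists y => //.
by apply/acc.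
Qed.
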